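(* Let $\mathcal G=(T,\mathbb I,\mathbb X,L,\mathit{Inv},\delta)$ be a reactive program game structure, $p\in\{\mathit{Sys},\mathit{Env}\}$ and $d\in\mathcal D$. For any choice of the heuristic functions $\textsc{Accelerate?}$ and $\textsc{Iterate?}$ and of the fresh symbols, if $\textsc{AttractorAcc}(\mathcal G,p,d)$ terminates returning $a$, then $[\![a]\!]=\mathit{Attr}_{[\![\mathcal G]\!],p}([\![d]\!])$.
   Context: Formulas are first-order; $\mathrm{FOL}(V)$ ($\mathrm{QF}(V)$) denotes (quantifier-free) formulas with free variables in $V$. A first-order theory $T$ is a set of interpretations of the function/predicate symbols; $\nu\models_T\varphi$ means $\nu,\mathcal I\models\varphi$ for all $\mathcal I\in T$, and a closed formula is valid if it holds in all $\mathcal I\in T$. For $\varphi\in\mathrm{FOL}(\mathbb X)$ and $u:\mathbb X\to$ terms, $\varphi[u]$ is the simultaneous substitution of each $x$ by $u(x)$. For a variable set $V$, $V'=\{x'\mid x\in V\}$ is a disjoint set of primed copies. Reactive program game structure $\mathcal G=(T,\mathbb I,\mathbb X,L,\mathit{Inv},\delta)$: $T$ a theory, $\mathbb I$ (inputs) and $\mathbb X$ (program variables) disjoint finite variable sets, $L$ finite set of locations, $\mathit{Inv}:L\to\mathrm{FOL}(\mathbb X)$, and finite $\delta\subseteq L\times\mathrm{QF}(\mathbb X\cup\mathbb I)\times(\mathbb X\to\text{terms})\times L$ such that for each $l$: (1) the guards of transitions leaving $l$ have $T$-valid disjunction and are pairwise $T$-exclusive; (2) $(l,g,u,l_1),(l,g,u,l_2)\in\delta$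 implies $l_1=l_2$; (3) for every assignment $\nu_x$ to $\mathbb X$ with $\nu_x\models_T\mathit{Inv}(l)$ there are $(l,g,u,l')\in\delta$ and an input assignment $\nu_i$ with $\nu_x\uplus\nu_i\models_T g$ and the updated assignment satisfying $\mathit{Inv}(l')$. Semantics $[\![\mathcal G]\!]$: states $S=\{(l,\nu)\mid\nu\models_T\mathit{Inv}(l)\}$; environment moves are assignments to $\mathbb I$, system moves are updates $u$ occurring in $\delta$; $((l,\nu),\nu_i,u,(l',\nu'))$ is a transition iff some $(l,g,u,l')\in\delta$ has $\nu\uplus\nu_i\models_T g$, $\nu'(x)$ is the value of $u(x)$ under $\nu\uplus\nu_i$, and $\nu'\models_T\mathit{Inv}(l')$. Each round the environment picks an enabled input, then the system an enabled update; strategies map histories (and, for $\mathit{Sys}$, the current input) to enabled moves. $\mathit{Attr}_{[\![\mathcal G]\!],p}(R)$ is the set of states from which player $p$ has a strategy guaranteeing that every resulting play visits $R$. Symbolic domain $\mathcal D=L\to\mathrm{FOL}(\mathbb X)$, $[\![d]\!]=\{(l,\nu)\in S\mid\nu\models_T d(l)\wedge\mathit{Inv}(l)\}$, pointwise Boolean operations, $d_1\equiv_T d_2$ iff $[\![d_1]\!]=[\![d_2]\!]$, $d[l\mapsto\varphi]$ changes the value at $l$ only, and $\{l\mapsto\varphi\}$ maps $l$ to $\varphi$ and all else to $\bot$. $\mathit{CPre}_{\mathcal G,\mathit{Env}}(d)=\lambda l.\ \mathit{Inv}(l)\wedge\exists\mathbb I.\bigwedge_{(l,g,u,l')\in\delta}(g\wedge\mathit{Inv}(l')[u]\to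 d(l')[u])$, $\mathit{CPre}_{\mathcal G,\mathit{Sys}}(d)=\lambda l.\ \mathit{Inv}(l)\wedge\forall\mathbb I.\bigvee_{(l,g,u,l')\in\delta}(g\wedge\mathit{Inv}(l')[u]\wedge d(l')[u])$ (computed syntactically, also for formulas containing uninterpreted symbols). Acceleration lemma over $V$: a triple $(\mathit{base},\mathit{step},\mathit{conc})$ with $\mathit{base},\mathit{conc}\in\mathrm{FOL}(V)$, $\mathit{step}\in\mathrm{FOL}(V\cup V')$ such that (i) every infinite sequence $\alpha$ of assignments to $V$ with $\alpha[0]\models_T\mathit{conc}$ and $\langle\alpha[i],\alpha[i+1]\rangle\models_T\mathit{step}$ for all $i$ has some $k$ with $\alpha[k]\models_T\mathit{base}$; (ii) for all $\nu,\nu'$ with $\nu\models_T\mathit{conc}$, $\nu\not\models_T\mathit{base}$ and $\langle\nu,\nu'\rangle\models_T\mathit{step}$, we have $\nu'\models_T\mathit{conc}$. Here $\langle\nu,\nu'\rangle$ maps $x\mapsto\nu(x)$, $x'\mapsto\nu'(x)$. $\mathsf{Lemmas}(V)$ is the set of these. Loop game: for $l_s\in L$ and fresh $l_E\notin L$, $\mathsf{LoopGame}(\mathcal G,l_s,l_E)=(T,\mathbb I,\mathbb X,L\cup\{l_E\},\mathit{Inv}\cup\{l_E\mapsto\mathit{Inv}(l_s)\},\delta')$ with $\delta'$ consisting of transitions of $\delta$ whose target is not $l_s$, the transitions $(l,g,u,l_E)$ for each $(l,g,u,l_s)\in\delta$, and $(l_E,\top,\lambda x.x,l_E)$. Lemma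 symbols: a countably infinite supply of triples $(b,st,c)$ of uninterpreted predicate symbols ($b,c$ of arity $|\mathbb X|$, $st$ of arity $2|\mathbb X|$). $\textsc{Accelerate?}$ and $\textsc{Iterate?}$ are arbitrary heuristic functions: $\textsc{Accelerate?}$ returns $\emptyset$ or a singleton $\{l\}$, $\textsc{Iterate?}$ returns a Boolean. $\mathsf{AccA}(\mathcal G,p,l,d)$: pick a fresh triple $(b,st,c)$; let $\mathcal G_{loop}=\mathsf{LoopGame}(\mathcal G,l,l_E)$ with fresh $l_E$; let $d_{loop}=d\cup\{l_E\mapsto st(E,\mathbb X)\}$ where $E=\{e_x\mid x\in\mathbb X\}$ are fresh uninterpreted constants; compute $(\Psi_{Rec},a):=\mathsf{IterA}(\mathcal G_{loop},p,\top,d_{loop})$ and then syntactically replace each $e_x$ by $x$ in $\Psi_{Rec}$ and $a$; set $\Psi:=(\forall\mathbb X.\ \mathit{Inv}(l)\wedge b(\mathbb X)\to d(l))\wedge(\forall\mathbb X.\ \mathit{Inv}(l)\wedge\neg d(l)\wedge c(\mathbb X)\to\Psi_{Rec}\wedge a(l))$, where the quantifiers bind the free occurrences of $\mathbb X$ (including those replacing $E$), with bound variables inside $\Psi_{Rec}$ and $a(l)$ renamed apart; return $(\Psi,\ c(\mathbb X)\wedge\mathit{Inv}(l))$. $\mathsf{IterA}(\mathcal G,p,\Psi,d)$: if $\neg\textsc{Iterate?}(\mathcal G,p,\Psi,d)$ return $(\Psi,d)$; if $\textsc{Accelerate?}(\mathcal G,p,\Psi,d)=\{l\}$, let $(\Psi_{Rec},\varphi):=\mathsf{AccA}(\mathcal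 G,p,l,d)$ and return $\mathsf{IterA}(\mathcal G,p,\Psi\wedge\Psi_{Rec},d[l\mapsto d(l)\vee\varphi])$; otherwise return $\mathsf{IterA}(\mathcal G,p,\Psi,d\vee\mathit{CPre}_{\mathcal G,p}(d))$. $\mathsf{InstantiateLemmas}(\Psi,\varphi)$: let $\mathit{Symb}$ be the set of lemma-symbol triples occurring in $\Psi,\varphi$; if some map $\lambda:\mathit{Symb}\to\mathsf{Lemmas}(\mathbb X)$ makes $\Psi[\lambda]$ valid, return $\varphi[\lambda]$, else return $\bot$. Here $\psi[\lambda]$ replaces, for $\lambda((b,st,c))=(\mathit{base},\mathit{step},\mathit{conc})$, each $b(\{t_x\})$ by $\mathit{base}[x\mapsto t_x]$, each $c(\{t_x\})$ by $\mathit{conc}[x\mapsto t_x]$, and each $st(\{t_x\},\{t'_x\})$ by $\mathit{step}[x\mapsto t_x,x'\mapsto t'_x]$. $\textsc{AttractorAcc}(\mathcal G,p,d)$: $a^0:=\lambda l.\bot$, $a^1:=d$; for $n=1,2,\dots$: if $a^n\equiv_T a^{n-1}$ return $a^n$; if $\textsc{Accelerate?}(\mathcal G,p,a^n)=\{l\}$, let $(\Psi,\varphi):=\mathsf{AccA}(\mathcal G,p,l,a^n)$ and set $a^n(l):=a^n(l)\vee\mathsf{InstantiateLemmas}(\Psi,\varphi)$; then set $a^{n+1}:=a^n\vee\mathit{CPre}_{\mathcal G,p}(a^n)$.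
   Formalization: Two hypotheses are added, as the claim fails without either: in every state every input assignment is enabled (condition (3) for all inputs, not just some), and all interpretations in T agree on the symbols of T's signature. *)

(* Defs.v *)
From Stdlib Require List.
From mathcomp Require Import all_boot.

Set Implicit Arguments.
Unset Strict Implicit.
Unset Printing Implicit Defensive.

(** * First-order logic *)

Record signature := Signature {
  fsym : Type; far : fsym -> nat;
  psym : Type; par : psym -> nat }.

(** [fm Sg V] is FOL(V): well-scoped de Bruijn syntax, where the variable bound
    by a quantifier is [None] and the surrounding ones are [Some v].  Hence
    substitution avoids capture by construction.  Equality is not a logical
    symbol; it may be one of the predicates of the signature. *)
Inductive tm (Sg : signature) (V : Type) : Type :=
| Var (v : V)
| App (f : fsym Sg) (args : 'I_(far f) -> tm Sg V).

Inductive fm (Sg : signature) (V : Type) : Type :=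
| fTop
| fBot
| fAtom (q : psym Sg) (args : 'I_(par q) -> tm Sg V)
| fNot (A : fm Sg V)
| fAnd (A B : fm Sg V)
| fOr (A B : fm Sg V)
| fImp (A B : fm Sg V)
| fAll (A : fm Sg (option V))
| fEx (A : fm Sg (option V)).

Arguments Var {Sg V}.
Arguments App {Sg V}.
Arguments fTop {Sg V}.
Arguments fBot {Sg V}.
Arguments fAtom {Sg V}.
Arguments fNot {Sg V}.
Arguments fAnd {Sg V}.
Arguments fOr {Sg V}.
Arguments fImp {Sg V}.
Arguments fAll {Sg V}.
Arguments fEx {Sg V}.

Fixpoint qf (Sg : signature) (V : Type) (A : fm Sg V) : bool :=
  match A with
  | fTop | fBot | fAtom _ _ => true
  | fNot A => qf A
  | fAnd A B | fOr A B | fImp A B => qf A && qf B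
  | fAll _ | fEx _ => false
  end.

Definition bigand (Sg : signature) (V : Type) (s : seq (fm Sg V)) :
    fm Sg V := foldr fAnd fTop s.
Definition bigor (Sg : signature) (V : Type) (s : seq (fm Sg V)) :
    fm Sg V := foldr fOr fBot s.

Fixpoint tsubst (Sg : signature) (V W : Type) (u : V -> tm Sg W)
    (t : tm Sg V) : tm Sg W :=
  match t with
  | Var v => u v
  | App f args => App f (fun i => tsubst u (args i))
  end.

Definition lift_subst (Sg : signature) (V W : Type) (u : V -> tm Sg W)
    (v : option V) :
    tm Sg (option W) :=
  match v with
  | None => Var None
  | Some v => tsubst (fun w => Var (Some w)) (u v)
  end.

Fixpoint subst (Sg : signature) (V W : Type) (u : V -> tm Sg W)
    (A : fm Sg V) : fm Sg W :=
  match A with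
  | fTop => fTop
  | fBot => fBot
  | fAtom q args => fAtom q (fun i => tsubst u (args i))
  | fNot A => fNot (subst u A)
  | fAnd A B => fAnd (subst u A) (subst u B)
  | fOr A B => fOr (subst u A) (subst u B)
  | fImp A B => fImp (subst u A) (subst u B)
  | fAll A => fAll (subst (lift_subst u) A)
  | fEx A => fEx (subst (lift_subst u) A)
  end.

Definition rename (Sg : signature) (V W : Type) (r : V -> W) :
    fm Sg V -> fm Sg W :=
  subst (fun v => Var (r v)).

(** Quantification over all variables of a finite set [B]: one quantifier per
    element of [B], following the enumeration of [B]. *)
Definition peel (V : Type) n (v : V + 'I_n.+1) : option (V + 'I_n) :=
  match v with
  | inl v => Some (inl v)
  | inr i => omap inr (unlift ord0 i)
  end.

Definition skip0 (V : Type) (v : V + 'I_0) : V :=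
  match v with
  | inl v => v
  | inr i => match notF (ltn_ord i) with end
  end.

Fixpoint quant_ord (Sg : signature)
    (Q : forall V : Type, fm Sg (option V) -> fm Sg V) (V : Type) n :
    fm Sg (V + 'I_n) -> fm Sg V :=
  match n with
  | 0 => fun A => rename (@skip0 V) A
  | m.+1 => fun A => quant_ord Q (Q _ (rename (@peel V m) A))
  end.

Definition quant_fin (Sg : signature)
    (Q : forall V : Type, fm Sg (option V) -> fm Sg V)
    (V : Type) (B : finType) (A : fm Sg (V + B)) : fm Sg V :=
  quant_ord Q (rename (fun v : V + B =>
    match v with inl v => inl v | inr b => inr (enum_rank b) end) A).

Definition all_fin (Sg : signature) (V : Type) (B : finType)
    (A : fm Sg (V + B)) :
    fm Sg V := quant_fin (@fAll Sg) A.
Definition ex_fin (Sg : signature) (V : Type) (B : finType)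
    (A : fm Sg (V + B)) :
    fm Sg V := quant_fin (@fEx Sg) A.
Definition all_closed (Sg : signature) (B : finType) (A : fm Sg B) :
    fm Sg void :=
  all_fin (rename inr A).

(** All interpretations range over one fixed set [D] of values, so that an
    assignment does not depend on the interpretation. *)
Record interp (Sg : signature) (D : Type) := Interp {
  fint : forall f : fsym Sg, ('I_(far f) -> D) -> D;
  pint : forall q : psym Sg, ('I_(par q) -> D) -> Prop }.

Fixpoint teval (Sg : signature) (D : Type) (J : interp Sg D) (V : Type)
    (nu : V -> D) (t : tm Sg V) : D :=
  match t with
  | Var v => nu v
  | App f args => fint J (fun i => teval J nu (args i))
  end.

Definition ocons (V D : Type) (x : D) (nu : V -> D) (v : option V) : D :=
  match v with None => x | Some v => nu v end.

Fixpoint sat (Sg : signature) (D : Type) (J : interp Sg D) (V : Type)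
    (nu : V -> D) (A : fm Sg V) : Prop :=
  match A with
  | fTop => True
  | fBot => False
  | fAtom q args => pint J (fun i => teval J nu (args i))
  | fNot A => ~ sat J nu A
  | fAnd A B => sat J nu A /\ sat J nu B
  | fOr A B => sat J nu A \/ sat J nu B
  | fImp A B => sat J nu A -> sat J nu B
  | fAll A => forall x : D, sat J (ocons x nu) A
  | fEx A => exists x : D, sat J (ocons x nu) A
  end.

Definition theory (Sg : signature) (D : Type) := interp Sg D -> Prop.

Definition models (Sg : signature) (D : Type) (T : theory Sg D) (V : Type)
    (nu : V -> D) (A : fm Sg V) : Prop :=
  forall J, T J -> sat J nu A.

Definition no_var (D : Type) (v : void) : D := match v with end.

Definition valid (Sg : signature) (D : Type) (T : theory Sg D)
    (A : fm Sg void) : Prop :=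
  models T (@no_var D) A.

(** The members of [T] agree on all symbols.  Only then is "the value of a
    term" defined, and [models T nu (fNot A)] the negation of [models T nu A]
    (for non-empty [T]). *)
Definition determinate (Sg : signature) (D : Type) (T : theory Sg D) : Prop :=
  forall J1 J2, T J1 -> T J2 ->
    (forall f a, @fint _ _ J1 f a = fint J2 a) /\
    (forall q a, @pint _ _ J1 q a <-> pint J2 a).

Definition uplus (V W D : Type) (nu : V -> D) (mu : W -> D) (v : V + W) : D :=
  match v with inl x => nu x | inr y => mu y end.

(** * Acceleration lemmas *)

(** In FOL(X + X'), [inl x] is x and [inr x] is x'. *)
Record lemma_triple (Sg : signature) (X : Type) := LemmaTriple {
  lbase : fm Sg X; lstep : fm Sg (X + X); lconc : fm Sg X }.

Definition acc_lemma (Sg : signature) (D : Type) (T : theory Sg D) (X : Type)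
    (m : lemma_triple Sg X) : Prop :=
  (forall alpha : nat -> X -> D,
     models T (alpha 0) (lconc m) ->
     (forall i, models T (uplus (alpha i) (alpha i.+1)) (lstep m)) ->
     exists k, models T (alpha k) (lbase m)) /\
  (forall nu nu' : X -> D,
     models T nu (lconc m) -> ~ models T nu (lbase m) ->
     models T (uplus nu nu') (lstep m) -> models T nu' (lconc m)).

(** * Uninterpreted symbols *)

(** [ext Sg X] adds to [Sg] the constants e_x, coming in countably many
    families (j, x), x in X, and countably many lemma-symbol triples
    (k, LBase), (k, LStep), (k, LConc). *)
Inductive lemma_symbol := LBase | LStep | LConc.

Definition ext_far (Sg : signature) (X : finType) (f : fsym Sg + nat * X) :=
  match f with inl f => far f | inr _ => 0 end.

Definition ext_par (Sg : signature) (X : finType)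
    (q : psym Sg + nat * lemma_symbol) :=
  match q with
  | inl q => par q
  | inr (_, LBase) | inr (_, LConc) => #|X|
  | inr (_, LStep) => #|X| + #|X|
  end.

Definition ext (Sg : signature) (X : finType) : signature :=
  Signature (@ext_far Sg X) (@ext_par Sg X).

Definition reduct (Sg : signature) (D : Type) (X : finType)
    (J : interp (ext Sg X) D) : interp Sg D :=
  Interp (fun f => @fint _ _ J (inl f)) (fun q => @pint _ _ J (inl q)).

(** [T] does not constrain the added symbols. *)
Definition ext_theory (Sg : signature) (D : Type) (X : finType)
    (T : theory Sg D) :
    theory (ext Sg X) D := fun J => T (reduct J).

Fixpoint tup (Sg : signature) (X : finType) (V : Type) (t : tm Sg V) : tm
    (ext Sg X) V :=
  match t with
  | Var v => Var v
  | App f args => @App (ext Sg X) V (inl f) (fun i => tup X (args i))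
  end.

Fixpoint up (Sg : signature) (X : finType) (V : Type) (A : fm Sg V) : fm
    (ext Sg X) V :=
  match A with
  | fTop => fTop
  | fBot => fBot
  | fAtom q args => @fAtom (ext Sg X) V (inl q) (fun i => tup X (args i))
  | fNot A => fNot (up X A)
  | fAnd A B => fAnd (up X A) (up X B)
  | fOr A B => fOr (up X A) (up X B)
  | fImp A B => fImp (up X A) (up X B)
  | fAll A => fAll (up X A)
  | fEx A => fEx (up X A)
  end.

Definition const_tm (Sg : signature) (X : finType) (V : Type) (j : nat)
    (x : X) : tm (ext Sg X) V :=
  @App (ext Sg X) V (inr (j, x)) (fun i => match notF (ltn_ord i) with end).

Definition base_atom (Sg : signature) (X : finType) (V : Type) (k : nat)
    (t : X -> tm (ext Sg X) V) : fm (ext Sg X) V :=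
  @fAtom (ext Sg X) V (inr (k, LBase)) (fun i => t (enum_val i)).

Definition conc_atom (Sg : signature) (X : finType) (V : Type) (k : nat)
    (t : X -> tm (ext Sg X) V) : fm (ext Sg X) V :=
  @fAtom (ext Sg X) V (inr (k, LConc)) (fun i => t (enum_val i)).

Definition step_atom (Sg : signature) (X : finType) (V : Type) (k : nat)
    (t t' : X -> tm (ext Sg X) V) : fm (ext Sg X) V :=
  @fAtom (ext Sg X) V (inr (k, LStep)) (fun i =>
    match split i with
    | inl i1 => t (enum_val i1)
    | inr i2 => t' (enum_val i2)
    end).

(** Replacement of each constant (j, x) by the variable [e x]; passing below a
    quantifier shifts [e], so the inserted variables are never captured. *)
Fixpoint tunconst (Sg : signature) (X : finType) (j : nat) (V : Type)
    (e : X -> V)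
    (t : tm (ext Sg X) V) : tm (ext Sg X) V :=
  match t with
  | Var v => Var v
  | App f args =>
    match f as f return ('I_(@far (ext Sg X) f) -> tm (ext Sg X) V) ->
                        tm (ext Sg X) V with
    | inl f => fun args' => @App (ext Sg X) V (inl f) args'
    | inr (j', x) => fun args' =>
        if j' == j then Var (e x) else @App (ext Sg X) V (inr (j', x)) args'
    end (fun i => tunconst j e (args i))
  end.

Fixpoint unconst (Sg : signature) (X : finType) (j : nat) (V : Type)
    (e : X -> V)
    (A : fm (ext Sg X) V) : fm (ext Sg X) V :=
  match A with
  | fTop => fTop
  | fBot => fBot
  | fAtom q args => fAtom q (fun i => tunconst j e (args i))
  | fNot A => fNot (unconst j e A)
  | fAnd A B => fAnd (unconst j e A) (unconst j e B)
  | fOr A B => fOr (unconst j e A) (unconst j e B)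
  | fImp A B => fImp (unconst j e A) (unconst j e B)
  | fAll A => fAll (unconst j (fun x => Some (e x)) A)
  | fEx A => fEx (unconst j (fun x => Some (e x)) A)
  end.

(** psi[lambda], for [lam] giving the lemma assigned to the k-th triple. *)
Fixpoint inst (Sg : signature) (X : finType) (lam : nat -> lemma_triple Sg X)
    (V : Type)
    (A : fm (ext Sg X) V) : fm (ext Sg X) V :=
  match A with
  | fTop => fTop
  | fBot => fBot
  | fAtom q args =>
    match q as q return ('I_(@par (ext Sg X) q) -> tm (ext Sg X) V) ->
                        fm (ext Sg X) V with
    | inl q => fun args => @fAtom (ext Sg X) V (inl q) args
    | inr (k, LBase) => fun args =>
        subst (fun x => args (enum_rank x)) (up X (lbase (lam k)))
    | inr (k, LConc) => fun args =>
        subst (fun x => args (enum_rank x)) (up X (lconc (lam k)))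
    | inr (k, LStep) => fun args =>
        subst (fun x : X + X =>
                 match x with
                 | inl x => args (lshift #|X| (enum_rank x))
                 | inr x => args (rshift #|X| (enum_rank x))
                 end) (up X (lstep (lam k)))
    end args
  | fNot A => fNot (inst lam A)
  | fAnd A B => fAnd (inst lam A) (inst lam B)
  | fOr A B => fOr (inst lam A) (inst lam B)
  | fImp A B => fImp (inst lam A) (inst lam B)
  | fAll A => fAll (inst lam A)
  | fEx A => fEx (inst lam A)
  end.

Fixpoint occurs (Sg : signature) (X : finType) (k : nat) (V : Type)
    (A : fm (ext Sg X) V) : bool :=
  match A with
  | fTop | fBot => false
  | fAtom q _ => match q with inl _ => false | inr (k', _) => k' == k end
  | fNot A => occurs k A
  | fAnd A B | fOr A B | fImp A B => occurs k A || occurs k B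
  | fAll A | fEx A => occurs k A
  end.

(** * Reactive program game structures *)

Inductive player := Sys | Env.

(** [X] are the program variables and [Y] the inputs. *)
Record transition (Sg : signature) (X Y : Type) (Loc : Type) := Transition {
  src : Loc; grd : fm Sg (X + Y); upd : X -> tm Sg (X + Y); dst : Loc }.

(** Locations are elements of a universe [Loc] of names; the values of [Inv],
    and of elements of the symbolic domain, outside [locs] are irrelevant. *)
Record rpg (Sg : signature) (D : Type) (X Y : finType) (Loc : eqType) := RPG {
  thy : theory Sg D;
  locs : seq Loc;
  Inv : Loc -> fm Sg X;
  delta : seq (transition Sg X Y Loc) }.

Definition updated (Sg : signature) (D : Type) (T : theory Sg D) (X Y : Type)
    (nu : X -> D) (mu : Y -> D) (u : X -> tm Sg (X + Y)) (nu' : X -> D) :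
    Prop :=
  forall J, T J -> forall x, nu' x = teval J (uplus nu mu) (u x).

Definition out (Sg : signature) (D : Type) (X Y : finType) (Loc : eqType)
    (G : rpg Sg D X Y Loc) (l : Loc) :=
  [seq t <- delta G | src t == l].

Definition rpg_wf (Sg : signature) (D : Type) (X Y : finType) (Loc : eqType)
    (G : rpg Sg D X Y Loc) : Prop :=
  (forall t, List.In t (delta G) ->
     [/\ src t \in locs G, dst t \in locs G & qf (grd t)]) /\
  (forall l, l \in locs G ->
    [/\ (forall nu, models (thy G) nu (bigor [seq grd t | t <- out G l])),
        (forall t1 t2, List.In t1 (out G l) -> List.In t2 (out G l) ->
           grd t1 <> grd t2 ->
           forall nu, models (thy G) nu (fNot (fAnd (grd t1) (grd t2)))),
        (forall t1 t2, List.In t1 (out G l) -> List.In t2 (out G l) ->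
           grd t1 = grd t2 -> upd t1 = upd t2 -> dst t1 = dst t2)
      & (forall nu, models (thy G) nu (Inv G l) ->
           exists t (mu : Y -> D) nu',
             [/\ List.In t (out G l), models (thy G) (uplus nu mu) (grd t),
                 updated (thy G) nu mu (upd t) nu'
               & models (thy G) nu' (Inv G (dst t))])]).

(** ** Semantics *)

Definition is_state (Sg : signature) (D : Type) (X Y : finType)
    (Loc : eqType) (G : rpg Sg D X Y Loc)
    (s : Loc * (X -> D)) : Prop :=
  s.1 \in locs G /\ models (thy G) s.2 (Inv G s.1).

Definition trans (Sg : signature) (D : Type) (X Y : finType) (Loc : eqType)
    (G : rpg Sg D X Y Loc) (s : Loc * (X -> D))
    (mu : Y -> D) (u : X -> tm Sg (X + Y)) (s' : Loc * (X -> D)) : Prop :=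
  is_state G s /\
  exists t, [/\ List.In t (out G s.1), upd t = u & dst t = s'.1] /\
    [/\ models (thy G) (uplus s.2 mu) (grd t),
        updated (thy G) s.2 mu u s'.2
      & models (thy G) s'.2 (Inv G s'.1)].

Definition enabled_env (Sg : signature) (D : Type) (X Y : finType)
    (Loc : eqType) (G : rpg Sg D X Y Loc)
    (s : Loc * (X -> D)) (mu : Y -> D) : Prop :=
  exists u s', trans G s mu u s'.

Definition enabled_sys (Sg : signature) (D : Type) (X Y : finType)
    (Loc : eqType) (G : rpg Sg D X Y Loc)
    (s : Loc * (X -> D)) (mu : Y -> D) (u : X -> tm Sg (X + Y)) : Prop :=
  exists s', trans G s mu u s'.

(** Stronger than the last clause of [rpg_wf], which provides one enabled input
    per state.  [cpre] below ranges over all inputs, enabled or not. *)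
Definition input_enabled (Sg : signature) (D : Type) (X Y : finType)
    (Loc : eqType) (G : rpg Sg D X Y Loc) : Prop :=
  forall s mu, is_state G s -> enabled_env G s mu.

(** A history is a list of past rounds, latest first, and the current state. *)
Definition round (Sg : signature) (D X Y Loc : Type) : Type :=
  (Loc * (X -> D)) * (Y -> D) * (X -> tm Sg (X + Y)).

Fixpoint is_history (Sg : signature) (D : Type) (X Y : finType)
    (Loc : eqType) (G : rpg Sg D X Y Loc)
    (h : seq (round Sg D X Y Loc)) (s : Loc * (X -> D)) : Prop :=
  match h with
  | [::] => is_state G s
  | (s0, mu, u) :: h' => is_history G h' s0 /\ trans G s0 mu u s
  end.

Definition env_strategy (Sg : signature) (D : Type) (X Y : finType)
    (Loc : eqType) (G : rpg Sg D X Y Loc)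
    (f : seq (round Sg D X Y Loc) -> Loc * (X -> D) -> Y -> D) : Prop :=
  forall h s, is_history G h s -> enabled_env G s (f h s).

Definition sys_strategy (Sg : signature) (D : Type) (X Y : finType)
    (Loc : eqType) (G : rpg Sg D X Y Loc)
    (f : seq (round Sg D X Y Loc) -> Loc * (X -> D) -> (Y -> D) ->
         X -> tm Sg (X + Y)) : Prop :=
  forall h s mu, is_history G h s -> enabled_env G s mu ->
    enabled_sys G s mu (f h s mu).

Record run (Sg : signature) (D X Y Loc : Type) := Run {
  rst : nat -> Loc * (X -> D);
  rin : nat -> Y -> D;
  rup : nat -> X -> tm Sg (X + Y) }.

Definition is_play (Sg : signature) (D : Type) (X Y : finType) (Loc : eqType)
    (G : rpg Sg D X Y Loc)
    (r : run Sg D X Y Loc) : Prop :=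
  forall n, trans G (rst r n) (rin r n) (rup r n) (rst r n.+1).

Fixpoint hist (Sg : signature) (D : Type) (X Y : finType) (Loc : eqType)
    (r : run Sg D X Y Loc) (n : nat) :
    seq (round Sg D X Y Loc) :=
  match n with
  | 0 => [::]
  | m.+1 => (rst r m, rin r m, rup r m) :: hist r m
  end.

Definition attr (Sg : signature) (D : Type) (X Y : finType) (Loc : eqType)
    (G : rpg Sg D X Y Loc) (p : player)
    (R : Loc * (X -> D) -> Prop) (s : Loc * (X -> D)) : Prop :=
  is_state G s /\
  match p with
  | Env => exists f, env_strategy G f /\
      forall r, is_play G r -> rst r 0 = s ->
        (forall n, rin r n = f (hist r n) (rst r n)) ->
        exists n, R (rst r n)
  | Sys => exists f, sys_strategy G f /\
      forall r, is_play G r -> rst r 0 = s ->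
        (forall n, rup r n = f (hist r n) (rst r n) (rin r n)) ->
        exists n, R (rst r n)
  end.

(** ** Symbolic domain *)

(** Elements of the domain are taken over [ext Sg X], since the algorithms also
    work on formulas with uninterpreted symbols; [updom] embeds L -> FOL(X). *)
Definition dom (Sg : signature) (X : finType) (Loc : Type) :
    Type := Loc -> fm (ext Sg X) X.

Definition updom (Sg : signature) (X : finType) (Loc : Type)
    (d : Loc -> fm Sg X) : dom Sg X Loc :=
  fun l => up X (d l).

Definition den (Sg : signature) (D : Type) (X Y : finType) (Loc : eqType)
    (G : rpg Sg D X Y Loc) (d : dom Sg X Loc)
    (s : Loc * (X -> D)) : Prop :=
  is_state G s /\
  models (ext_theory (X:=X) (thy G)) s.2 (fAnd (d s.1) (up X (Inv G s.1))).

Definition dequiv (Sg : signature) (D : Type) (X Y : finType) (Loc : eqType)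
    (G : rpg Sg D X Y Loc) (d1 d2 : dom Sg X Loc) :=
  forall s, den G d1 s <-> den G d2 s.

Definition dbot (Sg : signature) (X : finType) (Loc : Type) :
    dom Sg X Loc := fun _ => fBot.

Definition dor (Sg : signature) (X : finType) (Loc : Type)
    (d1 d2 : dom Sg X Loc) : dom Sg X Loc :=
  fun l => fOr (d1 l) (d2 l).

Definition dset (Sg : signature) (X : finType) (Loc : eqType)
    (d : dom Sg X Loc) (l : Loc)
    (A : fm (ext Sg X) X) : dom Sg X Loc :=
  fun l' => if l' == l then A else d l'.

Definition cpre (Sg : signature) (D : Type) (X Y : finType) (Loc : eqType)
    (G : rpg Sg D X Y Loc) (p : player)
    (d : dom Sg X Loc) : dom Sg X Loc :=
  let g t := up X (grd t) in
  let inv_post t := up X (subst (upd t) (Inv G (dst t))) in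
  let d' t := subst (fun x => tup X (upd t x)) (d (dst t)) in
  fun l =>
    fAnd (up X (Inv G l))
      match p with
      | Env => ex_fin (bigand
          [seq fImp (fAnd (g t) (inv_post t)) (d' t) | t <- out G l])
      | Sys => all_fin (bigor
          [seq fAnd (fAnd (g t) (inv_post t)) (d' t) | t <- out G l])
      end.

Definition loop_game (Sg : signature) (D : Type) (X Y : finType)
    (Loc : eqType) (G : rpg Sg D X Y Loc) (ls lE : Loc) :
    rpg Sg D X Y Loc :=
  RPG (thy G) (lE :: locs G)
    (fun l => if l == lE then Inv G ls else Inv G l)
    (Transition lE fTop (fun x => Var (inl x)) lE ::
     [seq if dst t == ls then Transition (src t) (grd t) (upd t) lE else t
       | t <- delta G]).

(** * Attractor computation with acceleration *)

(** The third argument of [accelerate] is [None] for the calls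
    Accelerate?(G, p, a), which carry no constraint. *)
Record heuristics (Sg : signature) (D : Type) (X Y : finType)
    (Loc : eqType) := Heuristics {
  accelerate : rpg Sg D X Y Loc -> player -> option (fm (ext Sg X) void) ->
    dom Sg X Loc -> option Loc;
  iterate : rpg Sg D X Y Loc -> player -> fm (ext Sg X) void ->
    dom Sg X Loc -> bool;
  accelerate_loc : forall G p Psi d l,
    accelerate G p Psi d = Some l -> l \in locs G }.

(** The indices of the lemma-symbol triples and of the families of constants
    that have already been picked; fresh ones are picked outside of these. *)
Record used := Used { utriples : seq nat; uconsts : seq nat }.

(** The algorithms are given as big-step relations: [accA H G p l d U Psi A U']
    means that AccA(G, p, l, d) may return (Psi, A), the used symbols being [U]
    before the call and [U'] after it. *)
Inductive accA (Sg : signature) (D : Type) (X Y : finType) (Loc : eqType)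
    (H : heuristics Sg D X Y Loc) :
  rpg Sg D X Y Loc -> player -> Loc -> dom Sg X Loc -> used ->
  fm (ext Sg X) void -> fm (ext Sg X) X -> used -> Prop :=
| AccA G p l d U k j lE Psi_rec a U' :
    k \notin utriples U -> j \notin uconsts U -> lE \notin locs G ->
    iterA H (loop_game G l lE) p fTop
      (dset d lE (step_atom k (fun x => const_tm _ _ j x) (fun x => Var x)))
      (Used (k :: utriples U) (j :: uconsts U)) Psi_rec a U' ->
    accA H G p l d U
      (fAnd
        (all_closed (fImp
           (fAnd (up X (Inv G l)) (base_atom k (fun x => Var x)))
           (d l)))
        (all_closed (fImp
           (fAnd (fAnd (up X (Inv G l)) (fNot (d l)))
                 (conc_atom k (fun x => Var x)))
           (fAnd (unconst j id (rename (fun v : void => match v with end)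
                                       Psi_rec))
                 (unconst j id (a l))))))
      (fAnd (conc_atom k (fun x => Var x)) (up X (Inv G l)))
      U'
with iterA (Sg : signature) (D : Type) (X Y : finType) (Loc : eqType)
    (H : heuristics Sg D X Y Loc) :
  rpg Sg D X Y Loc -> player -> fm (ext Sg X) void -> dom Sg X Loc -> used ->
  fm (ext Sg X) void -> dom Sg X Loc -> used -> Prop :=
| IterA_stop G p Psi d U :
    iterate H G p Psi d = false ->
    iterA H G p Psi d U Psi d U
| IterA_acc G p Psi d U l Psi_rec A U1 Psi' d' U2 :
    iterate H G p Psi d = true ->
    accelerate H G p (Some Psi) d = Some l ->
    accA H G p l d U Psi_rec A U1 ->
    iterA H G p (fAnd Psi Psi_rec) (dset d l (fOr (d l) A)) U1 Psi' d' U2 ->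
    iterA H G p Psi d U Psi' d' U2
| IterA_step G p Psi d U Psi' d' U' :
    iterate H G p Psi d = true ->
    accelerate H G p (Some Psi) d = None ->
    iterA H G p Psi (dor d (cpre G p d)) U Psi' d' U' ->
    iterA H G p Psi d U Psi' d' U'.

Definition good_instance (Sg : signature) (D : Type) (X : finType)
    (T : theory Sg D)
    (Psi : fm (ext Sg X) void) (A : fm (ext Sg X) X)
    (lam : nat -> lemma_triple Sg X) : Prop :=
  (forall k, occurs k Psi || occurs k A -> acc_lemma T (lam k)) /\
  valid (ext_theory (X:=X) T) (inst lam Psi).

Inductive instantiate_lemmas (Sg : signature) (D : Type) (X : finType)
    (T : theory Sg D)
    (Psi : fm (ext Sg X) void) (A : fm (ext Sg X) X) :
    fm (ext Sg X) X -> Prop :=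
| Inst_some lam : good_instance T Psi A lam ->
    instantiate_lemmas T Psi A (inst lam A)
| Inst_none : (forall lam, ~ good_instance T Psi A lam) ->
    instantiate_lemmas T Psi A fBot.

(** [attr_loop H G p b c U a]: the loop, entered with a^(n-1) = b and a^n = c,
    returns [a]. *)
Inductive attr_loop (Sg : signature) (D : Type) (X Y : finType)
    (Loc : eqType) (H : heuristics Sg D X Y Loc)
    (G : rpg Sg D X Y Loc) (p : player) :
    dom Sg X Loc -> dom Sg X Loc -> used -> dom Sg X Loc -> Prop :=
| Loop_return b c U :
    dequiv G c b -> attr_loop H G p b c U c
| Loop_acc b c U l Psi A U' A' a :
    ~ dequiv G c b ->
    accelerate H G p None c = Some l ->
    accA H G p l c U Psi A U' ->
    instantiate_lemmas (thy G) Psi A A' ->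
    (let c' := dset c l (fOr (c l) A') in
     attr_loop H G p c' (dor c' (cpre G p c')) U' a) ->
    attr_loop H G p b c U a
| Loop_step b c U a :
    ~ dequiv G c b ->
    accelerate H G p None c = None ->
    attr_loop H G p c (dor c (cpre G p c)) U a ->
    attr_loop H G p b c U a.

Definition attractor_acc (Sg : signature) (D : Type) (X Y : finType)
    (Loc : eqType) (H : heuristics Sg D X Y Loc)
    (G : rpg Sg D X Y Loc) (p : player) (d a : dom Sg X Loc) : Prop :=
  attr_loop H G p (@dbot Sg X Loc) d (Used [::] [::]) a.

(* Main.v *)
(** The attractor is the least fixpoint [win] of the controllable predecessor.
    Everything is read semantically: fix an interpretation of the uninterpreted
    symbols in which every triple (b, st, c) denotes an acceleration lemma.  If
    it satisfies the constraint computed by IterA, then the computed set is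
    contained in the attractor.  For AccA with constants E denoting the values
    of a state (l, nu) in c but not in d, the loop game shows that the player
    forces either d or a state (l, nu') with st(nu, nu'), which is in c again.
    Were (l, nu) not winning, this would repeat forever through non-winning
    states, whereas such a sequence meets b, hence d.  So the main loop only
    adds winning states, and when it stops its value is closed under
    predecessors. *)
Require Import Defs.
From Stdlib Require Import Classical ClassicalEpsilon FunctionalExtensionality.
From Stdlib Require List.
From mathcomp Require Import all_boot.

Set Implicit Arguments.
Unset Strict Implicit.
Unset Printing Implicit Defensive.

(** * Substitution and quantifiers *)

Lemma teval_tsubst (Sg : signature) (D V W : Type) (J : interp Sg D)
    (u : V -> tm Sg W) (nu : W -> D) (t : tm Sg V) :
  teval J nu (tsubst u t) = teval J (fun v => teval J nu (u v)) t.
Proof.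
elim: t => [v|f args IH] //=.
by congr fint; apply: functional_extensionality.
Qed.

Lemma sat_subst (Sg : signature) (D V W : Type) (J : interp Sg D)
    (u : V -> tm Sg W) (nu : W -> D) (A : fm Sg V) :
  sat J nu (subst u A) <-> sat J (fun v => teval J nu (u v)) A.
Proof.
have lift V' W' (u' : V' -> tm Sg W') nu' x :
    (fun v => teval J (ocons x nu') (lift_subst u' v)) =
    ocons x (fun v => teval J nu' (u' v)).
  apply: functional_extensionality => -[v|] //=.
  by rewrite teval_tsubst.
elim: A W u nu => {V}
  [V|V|V q args|V A IH|V A IHA B IHB|V A IHA B IHB|V A IHA B IHB|V A IH|V A IH]
  W u nu //=.
- suff -> : (fun i => teval J nu (tsubst u (args i))) =
            (fun i => teval J (fun v => teval J nu (u v)) (args i)) by [].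
  by apply: functional_extensionality => i; rewrite teval_tsubst.
- by rewrite IH.
- by rewrite IHA IHB.
- by rewrite IHA IHB.
- by rewrite IHA IHB.
- by split=> h x; move: (h x); rewrite IH lift.
- by split=> -[x h]; exists x; move: h; rewrite IH lift.
Qed.

Lemma sat_rename (Sg : signature) (D V W : Type) (J : interp Sg D)
    (r : V -> W) (nu : W -> D) (A : fm Sg V) :
  sat J nu (rename r A) <-> sat J (fun v => nu (r v)) A.
Proof. exact: sat_subst. Qed.

(** The innermost quantifier of [quant_ord] binds the index [ord0]; the right-hand side puts its
    value [x] in front of the tuple [mu]. *)
Lemma peel_ocons (D V : Type) n (x : D) (nu : V -> D) (mu : 'I_n -> D) :
  (fun v : V + 'I_n.+1 => ocons x (uplus nu mu) (peel v)) =
  uplus nu (fun i => ocons x mu (unlift ord0 i)).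
Proof.
apply: functional_extensionality => -[v|i] //=.
by case: unliftP.
Qed.

Lemma skip0_uplus (D V : Type) (nu : V -> D) (mu : 'I_0 -> D) :
  (fun v => nu (skip0 v)) = uplus nu mu.
Proof. by apply: functional_extensionality => -[v|[]]. Qed.

Lemma cons_unlift (D : Type) n (mu : 'I_n.+1 -> D) :
  (fun i => ocons (mu ord0) (fun j => mu (lift ord0 j)) (unlift ord0 i)) = mu.
Proof.
by apply: functional_extensionality => i; case: unliftP => [j|] ->.
Qed.

Lemma sat_all_ord (Sg : signature) (D V : Type) (J : interp Sg D) n
    (A : fm Sg (V + 'I_n)) (nu : V -> D) :
  sat J nu (quant_ord (@fAll Sg) A) <->
  forall mu : 'I_n -> D, sat J (uplus nu mu) A.
Proof.
elim: n A nu => [|n IH] A nu /=.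
  rewrite sat_rename; split=> [h mu|h].
    by rewrite -skip0_uplus.
  (* The empty tuple, which exists for every [D], instantiates the universal hypothesis. *)
  have mu0 : 'I_0 -> D by case.
  by rewrite (skip0_uplus nu mu0).
rewrite IH /=; split=> h mu.
  by rewrite -(cons_unlift mu) -peel_ocons -sat_rename.
by move=> x; rewrite sat_rename peel_ocons.
Qed.

Lemma sat_ex_ord (Sg : signature) (D V : Type) (J : interp Sg D) n
    (A : fm Sg (V + 'I_n)) (nu : V -> D) :
  sat J nu (quant_ord (@fEx Sg) A) <->
  exists mu : 'I_n -> D, sat J (uplus nu mu) A.
Proof.
elim: n A nu => [|n IH] A nu /=.
  rewrite sat_rename; split=> [h|[mu h]].
    have mu0 : 'I_0 -> D by case.
    by exists mu0; rewrite -skip0_uplus.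
  by rewrite (skip0_uplus nu mu).
rewrite IH /=; split=> -[mu].
  case=> x; rewrite sat_rename peel_ocons => h.
  by exists (fun i => ocons x mu (unlift ord0 i)).
rewrite -(cons_unlift mu) -peel_ocons -sat_rename => h.
by exists (fun j => mu (lift ord0 j)), (mu ord0).
Qed.

Lemma enum_rank_uplus (D V : Type) (B : finType) (nu : V -> D)
    (mu : 'I_#|B| -> D) :
  (fun v : V + B => uplus nu mu
     (match v with inl v => inl v | inr b => inr (enum_rank b) end)) =
  uplus nu (fun b => mu (enum_rank b)).
Proof. by apply: functional_extensionality => -[]. Qed.

Lemma enum_valK_fun (D : Type) (B : finType) (mu : B -> D) :
  (fun b => mu (enum_val (enum_rank b))) = mu.
Proof. by apply: functional_extensionality => b; rewrite enum_rankK. Qed.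

Lemma sat_all_fin (Sg : signature) (D V : Type) (B : finType)
    (J : interp Sg D) (A : fm Sg (V + B)) (nu : V -> D) :
  sat J nu (all_fin A) <-> forall mu : B -> D, sat J (uplus nu mu) A.
Proof.
rewrite /all_fin /quant_fin sat_all_ord; split=> h mu.
  move: (h (fun i => mu (enum_val i))).
  by rewrite sat_rename enum_rank_uplus enum_valK_fun.
by rewrite sat_rename enum_rank_uplus.
Qed.

Lemma sat_ex_fin (Sg : signature) (D V : Type) (B : finType)
    (J : interp Sg D) (A : fm Sg (V + B)) (nu : V -> D) :
  sat J nu (ex_fin A) <-> exists mu : B -> D, sat J (uplus nu mu) A.
Proof.
rewrite /ex_fin /quant_fin sat_ex_ord; split=> -[mu].
  rewrite sat_rename enum_rank_uplus => h.
  by exists (fun b => mu (enum_rank b)).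
move=> h; exists (fun i => mu (enum_val i)).
by rewrite sat_rename enum_rank_uplus enum_valK_fun.
Qed.

Lemma sat_all_closed (Sg : signature) (D : Type) (B : finType)
    (J : interp Sg D) (A : fm Sg B) (nu : void -> D) :
  sat J nu (all_closed A) <-> forall mu : B -> D, sat J mu A.
Proof.
by rewrite /all_closed sat_all_fin; split=> h mu; move: (h mu);
   rewrite sat_rename.
Qed.

Lemma sat_bigand (Sg : signature) (D V I : Type) (J : interp Sg D)
    (nu : V -> D) (F : I -> fm Sg V) (s : seq I) :
  sat J nu (bigand [seq F i | i <- s]) <->
  forall i, List.In i s -> sat J nu (F i).
Proof.
elim: s => [|i s IH] //=; rewrite IH; split=> [[h1 h2] j [<-|/h2]|h] //.
by split=> [|j hj]; apply: h; [left|right].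
Qed.

Lemma sat_bigor (Sg : signature) (D V I : Type) (J : interp Sg D)
    (nu : V -> D) (F : I -> fm Sg V) (s : seq I) :
  sat J nu (bigor [seq F i | i <- s]) <->
  exists i, List.In i s /\ sat J nu (F i).
Proof.
elim: s => [|i s IH] /=; first by split=> // -[? []].
rewrite IH; split=> [[h|[j [hj h]]]|[j [[->|hj] h]]].
- by exists i; split=> //; left.
- by exists j; split=> //; right.
- by left.
- by right; exists j.
Qed.

(** * Uninterpreted symbols *)

Lemma teval_tup (Sg : signature) (D : Type) (X : finType) (V : Type)
    (J : interp (ext Sg X) D) (nu : V -> D) (t : tm Sg V) :
  teval J nu (tup X t) = teval (reduct J) nu t.
Proof.
elim: t => [v|f args IH] //=.
suff -> : (fun i => teval J nu (tup X (args i))) =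
          (fun i => teval (reduct J) nu (args i)) by [].
exact: functional_extensionality.
Qed.

Lemma sat_up (Sg : signature) (D : Type) (X : finType) (V : Type)
    (J : interp (ext Sg X) D) (nu : V -> D) (A : fm Sg V) :
  sat J nu (up X A) <-> sat (reduct J) nu A.
Proof.
elim: A nu => {V}
  [V|V|V q args|V A IH|V A IHA B IHB|V A IHA B IHB|V A IHA B IHB|V A IH|V A IH]
  nu //=.
- suff -> : (fun i => teval J nu (tup X (args i))) =
            (fun i => teval (reduct J) nu (args i)) by [].
  by apply: functional_extensionality => i; rewrite teval_tup.
- by rewrite IH.
- by rewrite IHA IHB.
- by rewrite IHA IHB.
- by rewrite IHA IHB.
- by split=> h x; move: (h x); rewrite IH.
- by split=> -[x h]; exists x; move: h; rewrite IH.
Qed.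

(** * Interpretations of a determinate theory *)

Lemma determinate_teval (Sg : signature) (D : Type) (T : theory Sg D)
    (V : Type) (J1 J2 : interp Sg D) (nu : V -> D) (t : tm Sg V) :
  determinate T -> T J1 -> T J2 -> teval J1 nu t = teval J2 nu t.
Proof.
move=> T_det T1 T2; elim: t => [v|f args IH] //=.
have -> : (fun i => teval J1 nu (args i)) = (fun i => teval J2 nu (args i)).
  exact: functional_extensionality.
by case: (T_det _ _ T1 T2) => ->.
Qed.

Lemma determinate_sat (Sg : signature) (D : Type) (T : theory Sg D)
    (V : Type) (J1 J2 : interp Sg D) (nu : V -> D) (A : fm Sg V) :
  determinate T -> T J1 -> T J2 -> sat J1 nu A <-> sat J2 nu A.
Proof.
move=> T_det T1 T2; elim: A nu => {V}
  [V|V|V q args|V A IH|V A IHA B IHB|V A IHA B IHB|V A IHA B IHB|V A IH|V A IH]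
  nu //=.
- have -> : (fun i => teval J1 nu (args i)) = (fun i => teval J2 nu (args i)).
    by apply: functional_extensionality => i; apply: determinate_teval T1 T2.
  by case: (T_det _ _ T1 T2).
- by rewrite IH.
- by rewrite IHA IHB.
- by rewrite IHA IHB.
- by rewrite IHA IHB.
- by split=> h x; move: (h x); rewrite IH.
- by split=> -[x h]; exists x; move: h; rewrite IH.
Qed.

Lemma determinate_models (Sg : signature) (D : Type) (T : theory Sg D)
    (V : Type) (J : interp Sg D) (nu : V -> D) (A : fm Sg V) :
  determinate T -> T J -> models T nu A <-> sat J nu A.
Proof.
move=> T_det TJ; split=> [h|h J' TJ']; first exact: h.
exact/(determinate_sat nu A T_det TJ' TJ).
Qed.

Lemma sat_up_models (Sg : signature) (D : Type) (X : finType)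
    (T : theory Sg D) (V : Type) (J : interp (ext Sg X) D) (nu : V -> D)
    (A : fm Sg V) :
  determinate T -> ext_theory T J -> sat J nu (up X A) <-> models T nu A.
Proof. by move=> T_det TJ; rewrite sat_up (determinate_models _ _ T_det TJ). Qed.

(** The semantic counterpart of [unconst]: replacing the constants of family [j] by variables
    amounts to interpreting them by the values of those variables. *)
Definition set_consts (Sg : signature) (D : Type) (X : finType)
    (J : interp (ext Sg X) D) (j : nat) (v : X -> D) : interp (ext Sg X) D :=
  @Interp (ext Sg X) D
    (fun f => match f return ('I_(@far (ext Sg X) f) -> D) -> D with
     | inl f => @fint _ _ J (inl f)
     | inr (j', x) => fun a =>
         if j' == j then v x else @fint _ _ J (inr (j', x)) a
     end)
    (@pint _ _ J).

Lemma teval_unconst (Sg : signature) (D : Type) (X : finType)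
    (J : interp (ext Sg X) D) j (V : Type) (e : X -> V) (nu : V -> D)
    (t : tm (ext Sg X) V) :
  teval J nu (tunconst j e t) =
  teval (set_consts J j (fun x => nu (e x))) nu t.
Proof.
elim: t => [v|f args /functional_extensionality IH] //=.
case: f args IH => [f|[j' x]] args IH /=; first by rewrite IH.
by case: eqP => //= _; rewrite IH.
Qed.

Lemma sat_unconst (Sg : signature) (D : Type) (X : finType)
    (J : interp (ext Sg X) D) j (V : Type) (e : X -> V) (nu : V -> D)
    (A : fm (ext Sg X) V) :
  sat J nu (unconst j e A) <->
  sat (set_consts J j (fun x => nu (e x))) nu A.
Proof.
elim: A e nu => {V}
  [V|V|V q args|V A IH|V A IHA B IHB|V A IHA B IHB|V A IHA B IHB|V A IH|V A IH]
  e nu //=.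
- suff -> : (fun i => teval J nu (tunconst j e (args i))) =
     (fun i => teval (set_consts J j (fun x => nu (e x))) nu (args i)) by [].
  by apply: functional_extensionality => i; rewrite teval_unconst.
- by rewrite IH.
- by rewrite IHA IHB.
- by rewrite IHA IHB.
- by rewrite IHA IHB.
- by split=> h x; move: (h x); rewrite IH.
- by split=> -[x h]; exists x; move: h; rewrite IH.
Qed.

(** Lets the k-th triple denote the lemma [lam k], so that syntactic instantiation becomes a change
    of interpretation. *)
Definition set_lemmas (Sg : signature) (D : Type) (X : finType)
    (J : interp (ext Sg X) D) (lam : nat -> lemma_triple Sg X) :
    interp (ext Sg X) D :=
  @Interp (ext Sg X) D (@fint _ _ J)
    (fun q => match q return ('I_(@par (ext Sg X) q) -> D) -> Prop with
     | inl q => @pint _ _ J (inl q)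
     | inr (k, LBase) => fun a =>
         sat (reduct J) (fun x => a (enum_rank x)) (lbase (lam k))
     | inr (k, LConc) => fun a =>
         sat (reduct J) (fun x => a (enum_rank x)) (lconc (lam k))
     | inr (k, LStep) => fun a =>
         sat (reduct J)
           (uplus (fun x => a (lshift #|X| (enum_rank x)))
                  (fun x => a (rshift #|X| (enum_rank x))))
           (lstep (lam k))
     end).

Lemma teval_set_lemmas (Sg : signature) (D : Type) (X : finType)
    (J : interp (ext Sg X) D) lam (V : Type) (nu : V -> D)
    (t : tm (ext Sg X) V) :
  teval (set_lemmas J lam) nu t = teval J nu t.
Proof.
by elim: t => [v|f args /functional_extensionality IH] //=; rewrite IH.
Qed.

Lemma sat_inst (Sg : signature) (D : Type) (X : finType)
    (J : interp (ext Sg X) D) lam (V : Type) (nu : V -> D)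
    (A : fm (ext Sg X) V) :
  sat J nu (inst lam A) <-> sat (set_lemmas J lam) nu A.
Proof.
elim: A nu => {V}
  [V|V|V q args|V A IH|V A IHA B IHB|V A IHA B IHB|V A IHA B IHB|V A IH|V A IH]
  nu //=.
- have -> : (fun i => teval (set_lemmas J lam) nu (args i)) =
            (fun i => teval J nu (args i)).
    by apply: functional_extensionality => i; rewrite teval_set_lemmas.
  case: q args => [q|[k []]] args //=; rewrite sat_subst sat_up //.
  suff -> : (fun v : X + X => teval J nu
        match v with
        | inl x => args (lshift #|X| (enum_rank x))
        | inr x => args (rshift #|X| (enum_rank x))
        end) =
      uplus (fun x => teval J nu (args (lshift #|X| (enum_rank x))))
            (fun x => teval J nu (args (rshift #|X| (enum_rank x)))) by [].
  by apply: functional_extensionality => -[].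
- by rewrite IH.
- by rewrite IHA IHB.
- by rewrite IHA IHB.
- by rewrite IHA IHB.
- by split=> h x; move: (h x); rewrite IH.
- by split=> -[x h]; exists x; move: h; rewrite IH.
Qed.

Lemma eq_inst (Sg : signature) (X : finType) (V : Type)
    (lam1 lam2 : nat -> lemma_triple Sg X) (A : fm (ext Sg X) V) :
  (forall k, occurs k A -> lam1 k = lam2 k) -> inst lam1 A = inst lam2 A.
Proof.
elim: A => {V}
  [V|V|V q args|V A IH|V A IHA B IHB|V A IHA B IHB|V A IHA B IHB|V A IH|V A IH]
  //= h.
- by case: q args h => [//|[k []]] args /(_ k (eqxx k)) ->.
- by rewrite IH.
- by rewrite IHA ?IHB // => k hk; apply: h; rewrite hk ?orbT.
- by rewrite IHA ?IHB // => k hk; apply: h; rewrite hk ?orbT.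
- by rewrite IHA ?IHB // => k hk; apply: h; rewrite hk ?orbT.
- by rewrite IH.
- by rewrite IH.
Qed.

(** The two conditions of an acceleration lemma, asked of the relations that [J] gives to the k-th
    triple. Soundness of acceleration can thus be proved before lemmas are chosen. *)
Definition lemma_interp (Sg : signature) (D : Type) (X : finType)
    (J : interp (ext Sg X) D) (k : nat) : Prop :=
  let b nu := sat J nu (base_atom k (fun x : X => Var x)) in
  let c nu := sat J nu (conc_atom k (fun x : X => Var x)) in
  let st nu nu' := sat J (uplus nu nu')
    (step_atom k (fun x : X => Var (inl x)) (fun x => Var (inr x))) in
  (forall alpha, c (alpha 0) -> (forall i, st (alpha i) (alpha i.+1)) ->
     exists i, b (alpha i)) /\
  (forall nu nu', c nu -> ~ b nu -> st nu nu' -> c nu').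

(** With E read as [nu], the exit condition of the loop game says that the step relation leads from
    [nu] to the current assignment. *)
Lemma sat_step_const (Sg : signature) (D : Type) (X : finType)
    (J : interp (ext Sg X) D) k j (nu nu' : X -> D) :
  sat (set_consts J j nu) nu'
    (step_atom k (fun x => const_tm Sg X j x) (fun x => Var x)) <->
  sat J (uplus nu nu')
    (step_atom k (fun x : X => Var (inl x)) (fun x => Var (inr x))).
Proof.
rewrite /step_atom /=.
set a1 := (X in pint _ X <-> _); set a2 := (X in _ <-> pint _ X).
suff -> : a1 = a2 by [].
apply: functional_extensionality => i; rewrite /a1 /a2.
by case: (split i) => [x|x] //=; rewrite eqxx.
Qed.

(** In a determinate theory [models] is satisfaction in the reduct of [J], so the conditions on
    [lam k] transfer. [R] and [L] undo the passage between variables and argument positions. *)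
Lemma lemma_interp_set_lemmas (Sg : signature) (D : Type) (X : finType)
    (T : theory Sg D) (J : interp (ext Sg X) D) lam k :
  determinate T -> ext_theory T J -> acc_lemma T (lam k) ->
  lemma_interp (set_lemmas J lam) k.
Proof.
move=> T_det TJ [acc1 acc2].
have E V (nu : V -> D) A : sat (reduct J) nu A <-> models T nu A.
  by rewrite (determinate_models _ _ T_det TJ).
rewrite /lemma_interp /=.
have R (nu : X -> D) : (fun x => nu (enum_val (enum_rank x))) = nu.
  exact: enum_valK_fun.
have L (nu nu' : X -> D) :
  uplus (fun x => teval (set_lemmas J lam) (uplus nu nu')
          match split (lshift #|X| (enum_rank x)) with
          | inl i1 => Var (inl (enum_val i1))
          | inr i2 => Var (inr (enum_val i2))
          end)
        (fun x => teval (set_lemmas J lam) (uplus nu nu')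
          match split (rshift #|X| (enum_rank x)) with
          | inl i1 => Var (inl (enum_val i1))
          | inr i2 => Var (inr (enum_val i2))
          end) = uplus nu nu'.
  apply: functional_extensionality => -[x|x] /=.
    by rewrite (unsplitK (inl _)) /= enum_rankK.
  by rewrite (unsplitK (inr _)) /= enum_rankK.
split=> [alpha|nu nu'].
  rewrite R E => h0 h; case: (acc1 alpha h0) => [i|k'].
    by move: (h i); rewrite L E.
  by move=> hk; exists k'; rewrite R E.
by rewrite !R L !E; apply: acc2.
Qed.

(** * Attractors as least fixpoints *)

Lemma dependent_choice (A : Type) (P : A -> Prop) (R : A -> A -> Prop) x0 :
  P x0 -> (forall x, P x -> exists y, P y /\ R x y) ->
  exists f : nat -> A, f 0 = x0 /\ forall n, P (f n) /\ R (f n) (f n.+1).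
Proof.
move=> Px0 step.
have [g hg] : exists g : A -> A, forall x, P x -> P (g x) /\ R x (g x).
  apply: (choice (fun x y => P x -> P y /\ R x y)) => x.
  case: (classic (P x)) => [/step [y hy]|nPx]; first by exists y.
  by exists x0.
have Pn n : P (iter n g x0) by elim: n => [//|n /hg []].
by exists (fun n => iter n g x0); split=> // n; split=> //; case: (hg _ (Pn n)).
Qed.

(** [eff G p s M]: player [p] can force the round played in [s] to satisfy [M]. *)
Definition eff (Sg : signature) (D : Type) (X Y : finType) (Loc : eqType)
    (G : rpg Sg D X Y Loc) (p : player) (s : Loc * (X -> D))
    (M : (Y -> D) -> (X -> tm Sg (X + Y)) -> Prop) : Prop :=
  is_state G s /\
  match p with
  | Env => exists mu, enabled_env G s mu /\ forall u, M mu u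
  | Sys => forall mu, enabled_env G s mu ->
      exists u, enabled_sys G s mu u /\ M mu u
  end.

Lemma eff_mono (Sg : signature) (D : Type) (X Y : finType) (Loc : eqType)
    (G : rpg Sg D X Y Loc) p s
    (M N : (Y -> D) -> (X -> tm Sg (X + Y)) -> Prop) :
  (forall mu u, M mu u -> N mu u) -> eff G p s M -> eff G p s N.
Proof.
move=> MN [Gs h]; split=> //.
case: p h => [h mu /h [u [? /MN]]|[mu [? h]]]; first by exists u.
by exists mu; split=> // u; apply: MN.
Qed.

(** An inductive predicate rather than a union of finite stages, because with infinitely many inputs
    the number of rounds needed may have no finite bound. [M] is the set of rounds to which the
    player confines the game. *)
Inductive win (Sg : signature) (D : Type) (X Y : finType) (Loc : eqType)
    (G : rpg Sg D X Y Loc) (p : player) (R : Loc * (X -> D) -> Prop) :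
    Loc * (X -> D) -> Prop :=
| win_now s : R s -> win G p R s
| win_step s M : eff G p s M ->
    (forall mu u s', M mu u -> trans G s mu u s' -> win G p R s') ->
    win G p R s.

Lemma win_trans (Sg : signature) (D : Type) (X Y : finType) (Loc : eqType)
    (G : rpg Sg D X Y Loc) p (R1 R2 : Loc * (X -> D) -> Prop) s :
  (forall s, R1 s -> win G p R2 s) -> win G p R1 s -> win G p R2 s.
Proof.
move=> h; elim=> {s} [s /h //|s M eM _ IH].
exact: win_step eM IH.
Qed.

(** The properties of a game structure that loop games inherit. *)
Record regular (Sg : signature) (D : Type) (X Y : finType) (Loc : eqType)
    (G : rpg Sg D X Y Loc) : Prop := Regular {
  reg_locs : forall t, List.In t (delta G) ->
    src t \in locs G /\ dst t \in locs G;
  reg_dst : forall t1 t2 nu mu, List.In t1 (delta G) ->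
    List.In t2 (delta G) -> src t1 = src t2 -> upd t1 = upd t2 ->
    models (thy G) (uplus nu mu) (grd t1) ->
    models (thy G) (uplus nu mu) (grd t2) ->
    (exists J, thy G J) -> dst t1 = dst t2;
  reg_enabled : input_enabled G;
  reg_input : forall s, is_state G s -> exists mu, enabled_env G s mu }.

Lemma in_out (Sg : signature) (D : Type) (X Y : finType) (Loc : eqType)
    (G : rpg Sg D X Y Loc) l t :
  List.In t (out G l) <-> List.In t (delta G) /\ src t = l.
Proof.
rewrite /out; elim: (delta G) => [|t' s IH] /=; first by split=> [|[]].
case: eqP => h /=; rewrite IH; split.
- by case=> [<-|[]]; [split=> //; left|split=> //; right].
- by case=> -[->|h'] ht; [left|right].
- by case=> h1 h2; split=> //; right.
- by case=> -[ht|h'] h2; [case: h; rewrite ht|].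
Qed.

Lemma wf_regular (Sg : signature) (D : Type) (X Y : finType) (Loc : eqType)
    (G : rpg Sg D X Y Loc) : rpg_wf G -> input_enabled G -> regular G.
Proof.
case=> wf1 wf2 inp; split=> //.
- by move=> t /wf1 [].
- move=> t1 t2 nu mu h1 h2 e eu g1 g2 [J TJ].
  have [l1 _ _] := wf1 _ h1; have [_ ex same _] := wf2 _ l1.
  have o1 : List.In t1 (out G (src t1)) by apply/in_out.
  have o2 : List.In t2 (out G (src t1)) by apply/in_out.
  (* Distinct guards would exclude each other in [J], so the guards agree; with equal updates the
     targets then agree too. *)
  apply: same => //; apply: NNPP => ng.
  by case: (ex _ _ o1 o2 ng (uplus nu mu) J TJ); split; [apply: g1|apply: g2].
- move=> [l nu] [/= lG Inv_l]; have [_ _ _ h] := wf2 _ lG.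
  have [t [mu [nu' [ot gt ut it]]]] := h nu Inv_l.
  exists mu, (upd t), (dst t, nu'); split=> //.
  by exists t.
Qed.

Lemma trans_state (Sg : signature) (D : Type) (X Y : finType) (Loc : eqType)
    (G : rpg Sg D X Y Loc) s mu u s' :
  regular G -> trans G s mu u s' -> is_state G s'.
Proof.
move=> rG [_ [t [[/in_out [ot _] _ et] [_ _ it]]]]; split=> //.
by rewrite -et; case: (reg_locs rG ot).
Qed.

Lemma eff_round (Sg : signature) (D : Type) (X Y : finType) (Loc : eqType)
    (G : rpg Sg D X Y Loc) p s M :
  regular G -> eff G p s M -> exists mu u s', M mu u /\ trans G s mu u s'.
Proof.
move=> rG [Gs]; case: p => [h|[mu [[u [s' tr]] h]]].
  have [mu e] := reg_input rG Gs.
  have [u [[s' tr] Mu]] := h _ e.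
  by exists mu, u, s'.
by exists mu, u, s'.
Qed.

Lemma eff_top (Sg : signature) (D : Type) (X Y : finType) (Loc : eqType)
    (G : rpg Sg D X Y Loc) p s :
  regular G -> is_state G s -> eff G p s (fun _ _ => True).
Proof.
move=> rG Gs; split=> //; case: p => [mu [u h]|]; first by exists u.
by have [mu h] := reg_input rG Gs; exists mu.
Qed.

(** Nondeterministic strategies for both players: the set of rounds (input and
    update) that the player tolerates after a history. *)
Definition legal (Sg : signature) (D : Type) (X Y : finType) (Loc : eqType)
    (G : rpg Sg D X Y Loc) (p : player)
    (S : seq (round Sg D X Y Loc) -> Loc * (X -> D) -> (Y -> D) ->
         (X -> tm Sg (X + Y)) -> Prop) : Prop :=
  forall h s, is_history G h s -> eff G p s (S h s).

Definition wins (Sg : signature) (D : Type) (X Y : finType) (Loc : eqType)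
    (G : rpg Sg D X Y Loc)
    (S : seq (round Sg D X Y Loc) -> Loc * (X -> D) -> (Y -> D) ->
         (X -> tm Sg (X + Y)) -> Prop)
    (R : Loc * (X -> D) -> Prop) (s : Loc * (X -> D)) : Prop :=
  forall r, is_play G r -> rst r 0 = s ->
    (forall n, S (hist r n) (rst r n) (rin r n) (rup r n)) ->
    exists n, R (rst r n).

Lemma is_history_state (Sg : signature) (D : Type) (X Y : finType)
    (Loc : eqType) (G : rpg Sg D X Y Loc) h s :
  regular G -> is_history G h s -> is_state G s.
Proof. by move=> rG; case: h => [//|[[s0 mu] u] h] [_ /(trans_state rG)]. Qed.

Lemma is_history_hist (Sg : signature) (D : Type) (X Y : finType)
    (Loc : eqType) (G : rpg Sg D X Y Loc) r n :
  is_play G r -> is_history G (hist r n) (rst r n).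
Proof. by move=> pr; elim: n => [|n IH] /=; [case: (pr 0)|split]. Qed.

(** A strategy yields the set of rounds in which the player follows it. Conversely, choice selects
    one tolerated move in each situation; the plays that result are among those already won. *)
Lemma attr_legal (Sg : signature) (D : Type) (X Y : finType) (Loc : eqType)
    (G : rpg Sg D X Y Loc) p R s :
  regular G ->
  attr G p R s <-> is_state G s /\ exists S, legal G p S /\ wins G S R s.
Proof.
move=> rG; split=> -[Gs h]; split=> //.
  case: p h => -[f [sf wf]].
    exists (fun h s mu u => u = f h s mu); split=> // h s' hs.
    split; first exact: is_history_state hs.
    by move=> mu e; exists (f h s' mu); split=> //; apply: sf.
  exists (fun h s mu u => mu = f h s); split=> // h s' hs.
  split; first exact: is_history_state hs.
  by exists (f h s'); split=> //; apply: sf.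
case: p h => -[S [lS wS]].
  (* [u0] is a default update for arguments that are no history or whose input is not enabled. *)
  have [mu0 [u0 _]] := reg_input rG Gs.
  have [f hf] : exists f : seq (round Sg D X Y Loc) * (Loc * (X -> D)) *
      (Y -> D) -> X -> tm Sg (X + Y), forall a,
      is_history G a.1.1 a.1.2 -> enabled_env G a.1.2 a.2 ->
      enabled_sys G a.1.2 a.2 (f a) /\ S a.1.1 a.1.2 a.2 (f a).
    apply: (choice (fun a u => is_history G a.1.1 a.1.2 ->
      enabled_env G a.1.2 a.2 ->
      enabled_sys G a.1.2 a.2 u /\ S a.1.1 a.1.2 a.2 u)) => -[[h' s'] mu] /=.
    case: (classic (is_history G h' s' /\ enabled_env G s' mu)) => [[hh he]|n].
      by case: (lS _ _ hh) => _ /(_ mu he) [u hu]; exists u.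
    by exists u0 => hh he; case: n.
  exists (fun h s mu => f (h, s, mu)); split.
    by move=> h s' mu hh he; case: (hf (h, s', mu)).
  move=> r pr r0 fr; apply: wS => // n; rewrite fr.
  case: (hf (hist r n, rst r n, rin r n)) => //=; first exact: is_history_hist.
  by exists (rup r n), (rst r n.+1); apply: pr.
have [mu0 _] := reg_input rG Gs.
have [f hf] : exists f : seq (round Sg D X Y Loc) * (Loc * (X -> D)) -> Y -> D,
    forall a, is_history G a.1 a.2 ->
    enabled_env G a.2 (f a) /\ forall u, S a.1 a.2 (f a) u.
  apply: (choice (fun a mu => is_history G a.1 a.2 ->
    enabled_env G a.2 mu /\ forall u, S a.1 a.2 mu u)) => -[h' s'] /=.
  case: (classic (is_history G h' s')) => [hh|n]; last by exists mu0.
  by case: (lS _ _ hh) => _ [mu hmu]; exists mu.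
exists (fun h s => f (h, s)); split=> [h s' hh|r pr r0 fr].
  by case: (hf (h, s')).
apply: wS => // n; rewrite fr.
by case: (hf (hist r n, rst r n)) => //=; apply: is_history_hist.
Qed.

(** * Runs and histories without their first round *)

Definition shift_run (Sg : signature) (D X Y Loc : Type)
    (r : run Sg D X Y Loc) : run Sg D X Y Loc :=
  Run (fun n => rst r n.+1) (fun n => rin r n.+1) (fun n => rup r n.+1).

(** Histories list the latest round first, so the first round of the run is the last entry. *)
Lemma hist_shift (Sg : signature) (D : Type) (X Y : finType) (Loc : eqType)
    (r : run Sg D X Y Loc) n :
  hist r n.+1 = rcons (hist (shift_run r) n) (rst r 0, rin r 0, rup r 0).
Proof. by elim: n => [//|n IH]; rewrite /= -IH. Qed.

Definition first_state (Sg : signature) (D X Y Loc : Type)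
    (h : seq (round Sg D X Y Loc)) (s : Loc * (X -> D)) : Loc * (X -> D) :=
  last s [seq r.1.1 | r <- h].

Lemma first_state_hist (Sg : signature) (D : Type) (X Y : finType)
    (Loc : eqType) (r : run Sg D X Y Loc) n :
  first_state (hist r n) (rst r n) = rst r 0.
Proof. by elim: n => [//|n IH]; rewrite -IH. Qed.

Lemma is_history_rcons (Sg : signature) (D : Type) (X Y : finType)
    (Loc : eqType) (G : rpg Sg D X Y Loc) h x s :
  regular G -> is_history G (rcons h x) s -> is_history G h s.
Proof.
move=> rG; elim: h s => [|[[s0 mu] u] h IH] s /=.
  by case: x => [[s0 mu] u] [_ /(trans_state rG)].
by case=> /IH.
Qed.

(** By induction on [win]: after the first round, follow a strategy chosen for
    its target and forget that round. *)
Lemma win_attr (Sg : signature) (D : Type) (X Y : finType) (Loc : eqType)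
    (G : rpg Sg D X Y Loc) p R s :
  regular G -> is_state G s -> win G p R s -> attr G p R s.
Proof.
move=> rG Gs ws; apply/(attr_legal _ _ _ rG); split=> //.
have top_legal : legal G p (fun _ _ _ _ => True).
  by move=> h s' /(is_history_state rG); apply: eff_top.
elim: ws {Gs} => {s} [s Rs|s M eM _ IH].
  by exists (fun _ _ _ _ => True); split=> // r _ r0 _; exists 0; rewrite r0.
(* [F s'] wins from [s'] if a round in [M] leads from [s] to it; for the other states any legal set
   will do. *)
have [F hF] : exists F : Loc * (X -> D) ->
    seq (round Sg D X Y Loc) -> Loc * (X -> D) -> (Y -> D) ->
    (X -> tm Sg (X + Y)) -> Prop, forall s',
    legal G p (F s') /\
    ((exists mu u, M mu u /\ trans G s mu u s') -> wins G (F s') R s').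
  apply: (choice (fun s' S => legal G p S /\
    ((exists mu u, M mu u /\ trans G s mu u s') -> wins G S R s'))) => s'.
  case: (classic (exists mu u, M mu u /\ trans G s mu u s')) => [|n].
    by case=> mu [u [Mu tr]]; have [S [lS wS]] := IH _ _ _ Mu tr; exists S.
  by exists (fun _ _ _ _ => True).
(* After the first round, [h'] drops the earliest entry of the history, and [F] is taken at the
   state where [h'] starts. The premise [s1 = s] keeps [S] legal at other initial states, where [M]
   guarantees nothing. *)
pose S h s1 mu u :=
  if h is [::] then s1 = s -> M mu u
  else let h' := take (size h).-1 h in F (first_state h' s1) h' s1 mu u.
have S_rcons h x s1 : S (rcons h x) s1 = F (first_state h s1) h s1.
  by rewrite /S size_rcons -cats1 /= take_size_cat //; case: h.
exists S; split=> [h s1|r pr r0 fr].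
  case/lastP: h => [/= Gs1|h x hh].
    case: (classic (s1 = s)) => [->|n].
      by apply: eff_mono eM => mu u Mu _.
    by apply: eff_mono (eff_top _ rG Gs1) => mu u _ /n.
  rewrite S_rcons; apply: (hF _).1.
  exact: is_history_rcons hh.
have tr := pr 0; rewrite r0 in tr.
have [||n] := (hF (rst r 1)).2 _ (shift_run r) (fun n => pr n.+1) erefl.
- by exists (rin r 0), (rup r 0); split=> //; apply: (fr 0).
- move=> n; have := fr n.+1; rewrite hist_shift S_rcons.
  by have /= -> := first_state_hist (shift_run r) n.
by exists n.+1.
Qed.

(** By contraposition: if every tolerated round from a state led into [win], the state itself would
    be in [win]. So a non-winning state starts a play that obeys the strategy, stays outside [win]
    and hence never meets [R]. *)
Lemma attr_win (Sg : signature) (D : Type) (X Y : finType) (Loc : eqType)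
    (G : rpg Sg D X Y Loc) p R s :
  regular G -> attr G p R s -> win G p R s.
Proof.
move=> rG /(attr_legal _ _ _ rG) [Gs [S [lS wS]]]; apply: NNPP => nws.
pose P (a : seq (round Sg D X Y Loc) * (Loc * (X -> D))) :=
  is_history G a.1 a.2 /\ ~ win G p R a.2.
(* The chosen sequence carries its histories along, because the tolerated rounds depend on them. *)
pose N (a b : seq (round Sg D X Y Loc) * (Loc * (X -> D))) :=
  exists mu u, [/\ b.1 = (a.2, mu, u) :: a.1, S a.1 a.2 mu u
                 & trans G a.2 mu u b.2].
have [||f [f0 hf]] := @dependent_choice _ P N ([::], s); first by [].
  move=> [h s1] [/= hh nw]; apply: NNPP => nb; apply: nw.
  apply: win_step (lS _ _ hh) _ => mu u s' Su tr; apply: NNPP => nw'.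
  apply: nb; exists ((s1, mu, u) :: h, s'); split=> //.
  by exists mu, u.
have [g hg] : exists g : nat -> (Y -> D) * (X -> tm Sg (X + Y)), forall n,
    [/\ (f n.+1).1 = ((f n).2, (g n).1, (g n).2) :: (f n).1,
        S (f n).1 (f n).2 (g n).1 (g n).2
      & trans G (f n).2 (g n).1 (g n).2 (f n.+1).2].
  apply: (choice (fun n b => [/\ (f n.+1).1 = ((f n).2, b.1, b.2) :: (f n).1,
        S (f n).1 (f n).2 b.1 b.2
      & trans G (f n).2 b.1 b.2 (f n.+1).2])) => n.
  by case: (hf n) => _ [mu [u h]]; exists (mu, u).
pose r := Run (fun n => (f n).2) (fun n => (g n).1) (fun n => (g n).2).
have hr n : hist r n = (f n).1.
  by elim: n => [|n IH]; [rewrite f0|rewrite /= IH; case: (hg n) => ->].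
have [n|||n Rn] := wS r.
- by case: (hg n).
- by rewrite /= f0.
- by move=> n; rewrite hr; case: (hg n).
by case: (hf n) => -[_ nw] _; case: nw; apply: win_now.
Qed.

(** * Symbolic predecessors *)

Definition post (Sg : signature) (D : Type) (X Y : finType)
    (J : interp Sg D) (nu : X -> D) (mu : Y -> D)
    (u : X -> tm Sg (X + Y)) : X -> D :=
  fun x => teval J (uplus nu mu) (u x).

Lemma updatedP (Sg : signature) (D : Type) (X Y : finType) (T : theory Sg D)
    (J : interp Sg D) (nu : X -> D) (mu : Y -> D) u nu' :
  determinate T -> T J -> updated T nu mu u nu' <-> nu' = post J nu mu u.
Proof.
move=> T_det TJ; split=> [h|-> J' TJ' x].
  by apply: functional_extensionality => x; apply: h.
exact: determinate_teval TJ TJ'.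
Qed.

Definition holds (Sg : signature) (D : Type) (X Y : finType) (Loc : eqType)
    (G : rpg Sg D X Y Loc) (J : interp (ext Sg X) D) (d : dom Sg X Loc)
    (s : Loc * (X -> D)) : Prop :=
  is_state G s /\ sat J s.2 (d s.1).

Lemma transP (Sg : signature) (D : Type) (X Y : finType) (Loc : eqType)
    (G : rpg Sg D X Y Loc) (J : interp Sg D) s mu u s' :
  determinate (thy G) -> thy G J ->
  trans G s mu u s' <-> is_state G s /\
    exists t, [/\ List.In t (out G s.1), upd t = u,
                  models (thy G) (uplus s.2 mu) (grd t),
                  models (thy G) (post J s.2 mu u) (Inv G (dst t))
                & s' = (dst t, post J s.2 mu u)].
Proof.
move=> T_det TJ; split=> -[Gs [t]].
  case=> -[ot ut et] [gt /(updatedP _ _ _ _ T_det TJ) p it].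
  split=> //; exists t; split=> //; first by rewrite -p et.
  by case: s' et p it => l nu /= -> ->.
case=> ot ut gt it ->; split=> //; exists t; split=> //; split=> //.
exact/(updatedP _ _ _ _ T_det TJ).
Qed.

Lemma sat_cpre (Sg : signature) (D : Type) (X Y : finType) (Loc : eqType)
    (G : rpg Sg D X Y Loc) (J : interp (ext Sg X) D) p (d : dom Sg X Loc)
    l nu :
  determinate (thy G) -> ext_theory (thy G) J ->
  let P mu u := post (reduct J) nu mu u in
  let act t mu := models (thy G) (uplus nu mu) (grd t) /\
                  models (thy G) (P mu (upd t)) (Inv G (dst t)) in
  sat J nu (cpre G p d l) <-> models (thy G) nu (Inv G l) /\
  match p with
  | Env => exists mu : Y -> D, forall t, List.In t (out G l) -> act t mu ->
      sat J (P mu (upd t)) (d (dst t))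
  | Sys => forall mu : Y -> D, exists t, List.In t (out G l) /\
      (act t mu /\ sat J (P mu (upd t)) (d (dst t)))
  end.
Proof.
move=> T_det TJ P act.
have actP t mu : act t mu <-> sat J (uplus nu mu) (up X (grd t)) /\
    sat J (uplus nu mu) (up X (subst (upd t) (Inv G (dst t)))).
  rewrite (sat_up_models _ _ T_det TJ) sat_up sat_subst.
  by rewrite -(determinate_models _ _ T_det TJ).
have dP t mu : sat J (P mu (upd t)) (d (dst t)) <->
    sat J (uplus nu mu) (subst (fun x => tup X (upd t x)) (d (dst t))).
  rewrite sat_subst.
  suff -> : (fun x => teval J (uplus nu mu) (tup X (upd t x))) =
            P mu (upd t) by [].
  by apply: functional_extensionality => x; rewrite teval_tup.
rewrite /cpre /= (sat_up_models _ _ T_det TJ).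
case: p; [rewrite sat_all_fin|rewrite sat_ex_fin].
  split=> -[Inv_l h]; split=> // mu; move: (h mu).
    by rewrite sat_bigor /= => -[t ht]; exists t; rewrite actP dP.
  by rewrite sat_bigor /= => -[t]; rewrite actP dP => ht; exists t.
split=> -[Inv_l [mu h]]; split=> //; exists mu.
  by move/sat_bigand: h => h t /h /=; rewrite actP dP.
by apply/sat_bigand => t ot /=; rewrite -actP -dP; apply: h.
Qed.

(** [cpre] ranges over all inputs and [eff] over the enabled ones; input-enabledness reconciles
    them. For [Sys] the chosen update must also determine the target location, which is
    [reg_dst]. *)
Lemma cpre_eff (Sg : signature) (D : Type) (X Y : finType) (Loc : eqType)
    (G : rpg Sg D X Y Loc) (J : interp (ext Sg X) D) p (d : dom Sg X Loc) s :
  regular G -> determinate (thy G) -> ext_theory (thy G) J -> is_state G s ->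
  sat J s.2 (cpre G p d s.1) <->
  eff G p s (fun mu u => forall s', trans G s mu u s' -> holds G J d s').
Proof.
move=> rG T_det TJ Gs; rewrite (sat_cpre _ _ _ _ T_det TJ) /=.
have tr := transP s _ _ _ T_det TJ.
have en mu : enabled_env G s mu by apply: reg_enabled.
split=> [[_ h]|[_ h]]; (split; first by case: Gs).
  case: p h => [h mu _|[mu h]].
    have [t [ot [[gt it] dt]]] := h mu.
    exists (upd t); split.
      by exists (dst t, post (reduct J) s.2 mu (upd t)); apply/tr; split=> //;
         exists t.
    move=> s' trs; split; first exact: trans_state trs.
    have [_ [t' [ot' ut' gt' it' ->]]] := (tr _ _ _).1 trs.
    have [dt1 st1] := (in_out _ _ _).1 ot; have [dt2 st2] := (in_out _ _ _).1 ot'.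
    rewrite /= -(reg_dst rG dt1 dt2 _ (esym ut') gt gt') ?st1 ?st2 //.
    by exists (reduct J).
  exists mu; split=> // u s' trs; split; first exact: trans_state trs.
  have [_ [t [ot ut gt it ->]]] := (tr _ _ _).1 trs.
  by rewrite /= -ut; apply: h => //; rewrite ut.
case: p h => [h mu|[mu [_ h]]].
  have [u [[s' trs] hu]] := h mu (en mu).
  have [_ [t [ot ut gt it es]]] := (tr _ _ _).1 trs.
  exists t; split=> //; rewrite ut; split=> //.
  by have [] := hu _ trs; rewrite es.
exists mu => t ot [gt it].
have [] // := h (upd t) (dst t, post (reduct J) s.2 mu (upd t)).
by apply/tr; split=> //; exists t.
Qed.

(** * Loop games *)

Section LoopGame.

Variables (Sg : signature) (D : Type) (X Y : finType) (Loc : eqType).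
Variables (G : rpg Sg D X Y Loc) (l lE : Loc).
Hypotheses (rG : regular G) (lG : l \in locs G) (lE_new : lE \notin locs G).

Let G' := loop_game G l lE.

(** A round of [G] that reaches [l] ends in [lE] in the loop game. Both locations carry the
    invariant of [l], so the two translations preserve states. *)
Definition to_loop (s : Loc * (X -> D)) : Loc * (X -> D) :=
  (if s.1 == l then lE else s.1, s.2).

Definition from_loop (s : Loc * (X -> D)) : Loc * (X -> D) :=
  (if s.1 == lE then l else s.1, s.2).

Let redirect (t : transition Sg X Y Loc) :=
  if dst t == l then Transition (src t) (grd t) (upd t) lE else t.

Let redirectE t : [/\ src (redirect t) = src t, grd (redirect t) = grd t,
  upd (redirect t) = upd t & dst (redirect t) = if dst t == l then lE else dst t].
Proof. by rewrite /redirect; case: eqP. Qed.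

Lemma in_locs_neq l' : l' \in locs G -> (l' == lE) = false.
Proof. by move=> h; apply: contraNF lE_new => /eqP <-. Qed.

Lemma to_loopK s : is_state G s -> from_loop (to_loop s) = s.
Proof.
case: s => l' nu [/= /in_locs_neq n _]; rewrite /from_loop /to_loop /=.
by case: (eqVneq l' l) => [->|_]; rewrite ?eqxx ?n.
Qed.

Lemma in_delta_loop t : List.In t (delta G') <->
  t = Transition lE fTop (fun x => Var (inl x)) lE \/
  exists2 t0, List.In t0 (delta G) & t = redirect t0.
Proof.
rewrite /G' /= List.in_map_iff; split=> -[->|]; try by left.
  by case=> t0 [<- h]; right; exists t0.
by case=> t0 h ->; right; exists t0.
Qed.

Lemma is_state_from_loop s : is_state G' s <->
  (s.1 == lE) || (s.1 \in locs G) /\ is_state G (from_loop s).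
Proof.
rewrite /is_state /from_loop /G' /= inE; case: eqP => /= _.
  by split=> [[? ?]|[? []]].
by split=> [[? ?]|[? []]].
Qed.

Lemma is_state_loop s : s.1 \in locs G -> is_state G' s <-> is_state G s.
Proof.
move=> h; rewrite is_state_from_loop h orbT /from_loop in_locs_neq //.
by case: s h => l' nu /= _; split=> [[]|].
Qed.

Lemma is_state_to_loop s : is_state G s -> is_state G' (to_loop s).
Proof.
move=> Gs; apply/is_state_from_loop; rewrite to_loopK //; split=> //.
by case: Gs; rewrite /to_loop /=; case: (eqVneq s.1 l) => _ h _; rewrite ?eqxx ?h ?orbT.
Qed.

(** The source may be [l] itself: redirection changes targets only. *)
Lemma trans_to_loop s mu u s' :
  s.1 \in locs G -> trans G s mu u s' -> trans G' s mu u (to_loop s').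
Proof.
move=> ls tr; have Gs' := trans_state rG tr.
case: tr => Gs [t [[/in_out [dt st] ut et] [gt pt it]]].
split; first exact/is_state_loop.
have [rs rg ru rd] := redirectE t.
exists (redirect t); rewrite rg ru rd et; split; last first.
  by split=> //; case: (is_state_to_loop Gs').
split=> //; apply/in_out; rewrite rs; split=> //.
by apply/in_delta_loop; right; exists t.
Qed.

Lemma trans_from_loop s mu u s' :
  s.1 \in locs G -> trans G' s mu u s' -> trans G s mu u (from_loop s').
Proof.
move=> ls [/(is_state_loop ls) Gs [t [[/in_out [/in_delta_loop dt st] ut et]]]].
case: dt st ut et => [-> /= st|[t0 dt ->]].
  by move: lE_new; rewrite st ls.
have [-> -> -> ->] := redirectE t0 => st ut et [gt pt it].
have ln := in_locs_neq (reg_locs rG dt).2.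
split=> //; exists t0; split; last split=> //.
  split=> //; first exact/in_out.
  by rewrite /from_loop /= -et; case: (eqVneq (dst t0) l) => [->|_];
     rewrite ?eqxx ?ln.
by move: it; rewrite /from_loop /=; case: eqP.
Qed.

Lemma trans_loop_exit nu mu : is_state G' (lE, nu) ->
  trans G' (lE, nu) mu (fun x => Var (inl x)) (lE, nu).
Proof.
move=> Gs; split=> //.
exists (Transition lE fTop (fun x => Var (inl x)) lE); split; last first.
  by split=> //; case: Gs.
by split=> //; apply/in_out; split=> //; apply/in_delta_loop; left.
Qed.

(** The transitions of [G] have their sources in [locs G], so only the self-loop leaves [lE]. *)
Lemma trans_loop_exit_eq nu mu u s' : trans G' (lE, nu) mu u s' ->
  (exists J, thy G J) -> determinate (thy G) -> s' = (lE, nu).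
Proof.
case=> _ [t [[/in_out [/in_delta_loop dt st] ut et] [_ pt _]]] [J TJ] T_det.
case: dt => [dt|[t0 dt et0]].
  case: s' et pt => l' nu'; rewrite -ut dt /= => <-.
  by move=> /(updatedP _ _ _ _ T_det TJ) ->.
have [] := reg_locs rG dt; have [<- _ _ _] := redirectE t0.
by rewrite -et0 st (negbTE lE_new).
Qed.

Lemma loop_enabled s mu : is_state G' s -> enabled_env G' s mu.
Proof.
move=> Gs; have [] := (is_state_from_loop s).1 Gs; case: eqP => /= [es _ _|_ ls _].
  case: s es Gs => _ nu /= -> Gs.
  by exists (fun x => Var (inl x)), (lE, nu); apply: trans_loop_exit.
have [|u [s' tr]] := reg_enabled rG mu (s := s); first exact/is_state_loop.
by exists u, (to_loop s'); apply: trans_to_loop.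
Qed.

Lemma loop_regular : regular G'.
Proof.
have src_neq t0 : List.In t0 (delta G) -> lE = src t0 -> False.
  by move=> /(reg_locs rG) [ht _] e; move: lE_new; rewrite e ht.
split=> [t /in_delta_loop||s mu|s Gs].
- case=> [->|[t0 /(reg_locs rG) [h1 h2] ->]] /=; first by rewrite inE eqxx.
  have [-> _ _ ->] := redirectE t0; rewrite !inE h1 orbT; split=> //.
  by case: (eqVneq (dst t0) l) => _; rewrite ?eqxx ?h2 ?orbT.
- move=> t1 t2 nu mu /in_delta_loop h1 /in_delta_loop h2.
  case: h1 => [->|[t01 d1 ->]]; case: h2 => [->|[t02 d2 ->]] //=.
  + by have [-> _ _ _] := redirectE t02 => /(src_neq _ d2).
  + by have [-> _ _ _] := redirectE t01 => /esym /(src_neq _ d1).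
  have [-> -> -> ->] := redirectE t01; have [-> -> -> ->] := redirectE t02.
  by move=> es eu g1 g2 eJ; rewrite (reg_dst rG d1 d2 es eu g1 g2 eJ).
- exact: loop_enabled.
have [_ Gf] := (is_state_from_loop s).1 Gs.
by have [mu _] := reg_input rG Gf; exists mu; apply: loop_enabled.
Qed.

(** Redirecting the exits back to [l] turns a win in the loop game into a win in
    [G]; the absorbing location [lE] is passed through its own self-loop. *)
Lemma win_loop p (R' R : Loc * (X -> D) -> Prop) s :
  determinate (thy G) -> (exists J, thy G J) ->
  (forall s, R' s -> is_state G' s -> R (from_loop s)) ->
  win G' p R' s -> is_state G' s -> win G p R (from_loop s).
Proof.
move=> T_det eJ RR; elim=> {s} [s R's Gs|s M eM _ IH Gs].
  by apply: win_now; apply: RR.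
have [] := (is_state_from_loop s).1 Gs; case: eqP => /= [es _ _|nl ls Gf].
  (* At [lE] some round in [M] can be played and returns to the same state, so the induction
     hypothesis for its successor is the goal. *)
  have [mu [u [s' [Mu tr]]]] := eff_round loop_regular eM.
  have := IH _ _ _ Mu tr (trans_state loop_regular tr).
  case: s es tr {Gs eM IH} => _ nu /= -> tr.
  by rewrite (trans_loop_exit_eq tr eJ T_det).
have fs : from_loop s = s.
  by rewrite /from_loop; case: eqP => //; case: s {ls Gf Gs eM IH nl}.
rewrite fs in Gf *.
apply: (@win_step _ _ _ _ _ _ _ _ _ M) => [|mu u s' Mu tr].
  (* From an original location the rounds of both games correspond, with the same input and update,
     so [M] can be forced in [G] as well. *)
  split=> //; case: p eM {IH} => -[_ h] => [mu [u [s' tr]]|].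
    have [|u' [[s1 tr1] Mu]] := h mu.
      by exists u, (to_loop s'); apply: trans_to_loop.
    by exists u'; split=> //; exists (from_loop s1); apply: trans_from_loop.
  have [mu [[u [s' tr]] Mu]] := h.
  by exists mu; split=> //; exists u, (from_loop s'); apply: trans_from_loop.
have tr' := trans_to_loop ls tr.
rewrite -(to_loopK (trans_state rG tr)).
exact: IH tr' (trans_state loop_regular tr').
Qed.

End LoopGame.

(** * Soundness of acceleration *)

(** Freshness is expressed by truth values instead of occurrences. With [same_upto_const j] for [E],
    the constants of family [j] have no influence; with the full relation, no added symbol has
    any. *)
Definition stable (Sg : signature) (D : Type) (X : finType) (T : theory Sg D)
    (E : interp (ext Sg X) D -> interp (ext Sg X) D -> Prop) (V : Type)
    (A : fm (ext Sg X) V) : Prop :=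
  forall J J', ext_theory T J -> ext_theory T J' -> E J J' ->
  forall nu, sat J nu A <-> sat J' nu A.

Lemma stable_or (Sg : signature) (D : Type) (X : finType) (T : theory Sg D)
    (E : interp (ext Sg X) D -> interp (ext Sg X) D -> Prop) (V : Type)
    (A B : fm (ext Sg X) V) :
  stable T E A -> stable T E B -> stable T E (fOr A B).
Proof.
by move=> hA hB J J' TJ TJ' e nu /=; rewrite (hA J J') // (hB J J').
Qed.

Lemma stable_up (Sg : signature) (D : Type) (X : finType) (T : theory Sg D)
    (E : interp (ext Sg X) D -> interp (ext Sg X) D -> Prop) (V : Type)
    (A : fm Sg V) :
  determinate T -> stable T E (up X A).
Proof. by move=> T_det J J' TJ TJ' _ nu; rewrite !(sat_up_models _ _ T_det). Qed.

Lemma stable_cpre (Sg : signature) (D : Type) (X Y : finType) (Loc : eqType)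
    (G : rpg Sg D X Y Loc) p (d : dom Sg X Loc)
    (E : interp (ext Sg X) D -> interp (ext Sg X) D -> Prop) :
  determinate (thy G) -> (forall l, stable (thy G) E (d l)) ->
  forall l, stable (thy G) E (cpre G p d l).
Proof.
move=> T_det sd l J J' TJ TJ' e nu.
rewrite (sat_cpre _ _ _ _ T_det TJ) (sat_cpre _ _ _ _ T_det TJ') /=.
have P mu u : post (Y := Y) (reduct J) nu mu u = post (reduct J') nu mu u.
  apply: functional_extensionality => x; exact: (@determinate_teval _ _ (thy G)).
split=> -[Inv_l h]; split=> //; case: p h => [h mu|[mu h]].
- have [t [ot [act dt]]] := h mu; exists t.
  by rewrite -P; split=> //; split=> //; apply/(sd (dst t) J J' TJ TJ' e).
- by exists mu => t ot; rewrite -P => act; apply/(sd (dst t) J J' TJ TJ' e); apply: h.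
- have [t [ot [act dt]]] := h mu; exists t.
  by rewrite P; split=> //; split=> //; apply/(sd (dst t) J J' TJ TJ' e).
- by exists mu => t ot; rewrite P => act; apply/(sd (dst t) J J' TJ TJ' e); apply: h.
Qed.

Definition same_upto_const (Sg : signature) (D : Type) (X : finType) (j : nat)
    (J J' : interp (ext Sg X) D) : Prop :=
  exists v, J' = set_consts J j v.

Definition fresh_consts (Sg : signature) (D : Type) (X : finType)
    (Loc : Type) (T : theory Sg D) (U : used) (d : dom Sg X Loc) : Prop :=
  forall j l, j \notin uconsts U -> stable T (same_upto_const j) (d l).

Lemma sat_step_set_consts (Sg : signature) (D : Type) (X : finType)
    (J : interp (ext Sg X) D) k j v (nu : X + X -> D) :
  sat (set_consts J j v) nu
    (step_atom k (fun x : X => Var (inl x)) (fun x => Var (inr x))) <->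
  sat J nu (step_atom k (fun x : X => Var (inl x)) (fun x => Var (inr x))).
Proof.
rewrite /step_atom /=.
set a1 := (X in pint _ X <-> _); set a2 := (X in _ <-> pint _ X).
suff -> : a1 = a2 by [].
by apply: functional_extensionality => i; rewrite /a1 /a2; case: (split i).
Qed.

Lemma lemma_interp_set_consts (Sg : signature) (D : Type) (X : finType)
    (J : interp (ext Sg X) D) k j v :
  lemma_interp J k -> lemma_interp (set_consts J j v) k.
Proof.
move=> [h1 h2]; split=> [alpha c st|nu nu' c b /sat_step_set_consts st].
  by apply: h1 => // i; apply/sat_step_set_consts.
exact: h2 c b st.
Qed.

Lemma fresh_step_const (Sg : signature) (D : Type) (X : finType)
    (T : theory Sg D) k j j' :
  j' != j ->
  stable T (@same_upto_const Sg D X j')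
    (step_atom k (fun x => const_tm Sg X j x) (fun x => Var x)).
Proof.
move=> nj J _ _ _ [v ->] nu; rewrite /step_atom /=.
set a1 := (X in pint _ X <-> _); set a2 := (X in _ <-> pint _ X).
suff -> : a1 = a2 by [].
apply: functional_extensionality => i; rewrite /a1 /a2.
case: (split i) => x //=; rewrite eq_sym (negbTE nj).
by congr fint; apply: functional_extensionality; case.
Qed.

Lemma fresh_consts_incl (Sg : signature) (D : Type) (X : finType)
    (Loc : Type) (T : theory Sg D) (U U' : used) (d : dom Sg X Loc) :
  {subset uconsts U <= uconsts U'} -> fresh_consts T U d ->
  fresh_consts T U' d.
Proof. by move=> UU' fd j l hj; apply: fd; apply: contra hj => /UU'. Qed.

Lemma fresh_consts_dset (Sg : signature) (D : Type) (X : finType)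
    (Loc : eqType) (T : theory Sg D) (U : used) (d : dom Sg X Loc) l A :
  fresh_consts T U d ->
  (forall j, j \notin uconsts U -> stable T (same_upto_const j) A) ->
  fresh_consts T U (dset d l A).
Proof.
move=> fd fA j l' hj; rewrite /dset; case: eqP => _; [exact: fA|exact: fd].
Qed.

Section Accelerate.

Variables (Sg : signature) (D : Type) (X Y : finType) (Loc : eqType).
Variables (G : rpg Sg D X Y Loc) (p : player) (J : interp (ext Sg X) D).
Variables (l lE : Loc) (d : dom Sg X Loc) (k j : nat).
Hypotheses (rG : regular G) (T_det : determinate (thy G)).
Hypotheses (TJ : ext_theory (thy G) J) (accJ : forall k, lemma_interp J k).
Hypotheses (lG : l \in locs G) (lE_new : lE \notin locs G).
Hypothesis j_new : forall l, stable (thy G) (same_upto_const j) (d l).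

Let G' := loop_game G l lE.
Let d' := dset d lE
  (step_atom k (fun x => const_tm Sg X j x) (fun x : X => Var x)).
Let b nu := sat J nu (base_atom k (fun x : X => Var x)).
Let c nu := sat J nu (conc_atom k (fun x : X => Var x)).
Let st nu nu' := sat J (uplus nu nu')
  (step_atom k (fun x : X => Var (inl x)) (fun x => Var (inr x))).

Hypothesis base_d : forall nu, models (thy G) nu (Inv G l) -> b nu ->
  sat J nu (d l).
Hypothesis loop_win : forall nu, models (thy G) nu (Inv G l) ->
  ~ sat J nu (d l) -> c nu ->
  win G' p (holds G' (set_consts J j nu) d') (l, nu).

(** As long as [l] is not winning, the loop game yields another non-winning
    state at [l] related by [st]; such a sequence cannot avoid [b]. *)
Lemma conc_win nu : is_state G (l, nu) -> c nu ->
  win G p (holds G J d) (l, nu).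
Proof.
move=> Gs cnu; apply: NNPP => nw.
pose P nu := [/\ is_state G (l, nu), c nu & ~ win G p (holds G J d) (l, nu)].
have nd nu1 : P nu1 -> ~ sat J nu1 (d l).
  by case=> G1 _ nw1 dl; case: nw1; apply: win_now.
have [||f [f0 hf]] := @dependent_choice _ P st nu; first by [].
  move=> {cnu nw Gs}nu P1; have [Gs cnu nw] := P1.
  apply: NNPP => stuck; apply: nw.
  have Inv_l : models (thy G) nu (Inv G l) by case: Gs.
  (* A win in the loop game reaches either [d] or the exit [lE]; the latter is read back as a state
     at [l] one step away from [nu]. *)
  pose R s := holds G J d s \/ [/\ is_state G s, s.1 = l & st nu s.2].
  have RR s : holds G' (set_consts J j nu) d' s -> is_state G' s ->
      R (from_loop l lE s).
    case=> _ ds Gs'; have [] := (is_state_from_loop lE lG s).1 Gs'.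
    move: ds; rewrite /from_loop /d' /dset; case: eqP => /= [es|nE] ds _ Gf.
      by right; split=> //; apply/(sat_step_const J k j).
    left; split; first by case: s Gf {nE ds Gs'}.
    case: s ds Gf {nE Gs'} => l1 nu1 /= ds Gf.
    by apply/(j_new l1 (J' := set_consts J j nu)) => //; exists nu.
  have eJ : exists J0, thy G J0 by exists (reduct J).
  have Gs' : is_state G' (l, nu) by apply/is_state_loop.
  have w := win_loop rG lG lE_new T_det eJ RR (loop_win Inv_l (nd _ P1) cnu) Gs'.
  move: w; rewrite /from_loop /= (in_locs_neq lE_new lG).
  apply: win_trans => s; case=> [|[Gs1 es st1]]; first exact: win_now.
  (* A non-winning exit would continue the sequence: [b] fails at [nu], since it would imply [d], so
     [c] passes on to the exit. *)
  apply: NNPP => nw1; apply: stuck; exists s.2; split=> //.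
  case: s es st1 Gs1 nw1 => _ nu1 /= -> st1 Gs1 nw1; split=> //.
  have [_ next] := accJ k; apply: next cnu _ st1 => bnu.
  exact: nd P1 (base_d Inv_l bnu).
(* The first condition on the lemma makes the sequence meet [b], hence [d], although all its states
   are non-winning. *)
have [term _] := accJ k.
have [||i bi] := term f; first by rewrite f0.
  by move=> i; case: (hf i).
have [Pi _] := hf i; apply: (nd _ Pi); apply: base_d => //.
by case: Pi => -[].
Qed.

End Accelerate.

(* Soundness of [accA] and [iterA] *)
Scheme accA_min := Minimality for accA Sort Prop
  with iterA_min := Minimality for iterA Sort Prop.
Combined Scheme accA_iterA_ind from accA_min, iterA_min.

(** Mutual induction on the runs. [J] stays quantified in the conclusion because the recursive
    result is used, for each state, in the interpretation where E denotes its values. The growth of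
    the used constants and the shape of [A] keep the current value independent of constants still to
    be picked. *)
Lemma accA_iterA_sound (Sg : signature) (D : Type) (X Y : finType)
    (Loc : eqType) (H : heuristics Sg D X Y Loc) :
  (forall G p l d U Psi A U', accA H G p l d U Psi A U' ->
    regular G -> determinate (thy G) -> l \in locs G ->
    fresh_consts (thy G) U d ->
    [/\ {subset uconsts U <= uconsts U'},
        (exists k, A = fAnd (conc_atom k (fun x => Var x)) (up X (Inv G l)))
      & forall J n, ext_theory (thy G) J -> (forall k, lemma_interp J k) ->
        sat J n Psi -> forall nu, is_state G (l, nu) -> sat J nu A ->
        win G p (holds G J d) (l, nu)]) /\
  (forall G p Psi d U Psi' d' U', iterA H G p Psi d U Psi' d' U' ->
    regular G -> determinate (thy G) -> fresh_consts (thy G) U d ->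
    {subset uconsts U <= uconsts U'} /\
    forall J n, ext_theory (thy G) J -> (forall k, lemma_interp J k) ->
      sat J n Psi' -> sat J n Psi /\
      forall s, holds G J d' s -> win G p (holds G J d) s).
Proof.
apply: accA_iterA_ind.
- move=> G p l d U k j lE Psi_rec a U' _ j_new lE_new _ IH rG T_det lG fd.
  have [|sub sound] := IH (loop_regular rG lG lE_new) T_det.
    apply: fresh_consts_dset.
      by apply: fresh_consts_incl fd => i; rewrite inE orbC => ->.
    move=> j'; rewrite inE negb_or => /andP[nj _].
    exact: fresh_step_const.
  split=> [i Ui||J n TJ accJ [hbase hloop] nu Gs [cnu _]].
  + by apply: sub; rewrite inE Ui orbT.
  + by exists k.
  move/sat_all_closed: hbase => hbase; move/sat_all_closed: hloop => hloop.
  apply: (conc_win rG T_det TJ accJ lG lE_new (k := k) (j := j)) => //.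
  + by move=> l'; apply: fd.
  + move=> nu1 Inv1 b1; apply: hbase; split=> //.
    exact/(sat_up_models _ _ T_det TJ).
  move=> nu1 Inv1 nd1 c1; have [] := hloop nu1.
    by split=> //; split=> //; apply/(sat_up_models _ _ T_det TJ).
  (* The closed constraint, taken at [nu1], says that [Psi_rec] and [a l] hold once E is interpreted
     as [nu1]. *)
  move=> /sat_unconst/sat_rename h1 /sat_unconst h2.
  have [|_] := sound (set_consts J j nu1) _ TJ _ h1.
    by move=> k'; apply: lemma_interp_set_consts.
  apply; split=> //.
  by apply/is_state_loop => //; split.
- by move=> G p Psi d U _ rG T_det fd; split=> // J n TJ accJ hPsi; split=> //;
     move=> s; apply: win_now.
- move=> G p Psi d U l Psi_rec A U1 Psi' d' U2 _ acc _ IHacc _ IH rG T_det fd.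
  have lG := accelerate_loc acc.
  have [sub1 [k eA] sound1] := IHacc rG T_det lG fd.
  have fd1 := fresh_consts_incl sub1 fd.
  have [|sub2 sound2] := IH rG T_det.
    (* The new disjunct consists of a lemma symbol and an invariant and contains no added
       constant. *)
    apply: fresh_consts_dset => // j hj; apply: stable_or; first exact: fd1.
    rewrite eA => J J' TJ TJ' [v eJ] nu /=.
    have -> : sat J' nu (up X (Inv G l)) <-> sat J nu (up X (Inv G l)).
      by rewrite !(sat_up_models _ _ T_det).
    by rewrite eJ.
  split=> [i /sub1 /sub2 //|J n TJ accJ hPsi'].
  have [[hPsi hrec] w] := sound2 J n TJ accJ hPsi'; split=> // s /w.
  apply: win_trans => -[l' nu] [Gs]; rewrite /dset /=.
  case: eqP => [el|_] hd; last exact: win_now.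
  move: Gs; rewrite el => Gs; case: hd => hd; first exact: win_now.
  exact: sound1 hrec _ Gs hd.
- move=> G p Psi d U Psi' d' U' _ _ _ IH rG T_det fd.
  have [|sub sound] := IH rG T_det.
    by move=> j l hj; apply: stable_or; [|apply: stable_cpre => // l']; apply: fd.
  split=> // J n TJ accJ hPsi'.
  have [hPsi w] := sound J n TJ accJ hPsi'; split=> // s /w.
  apply: win_trans => {}s [Gs [ds|hc]]; first exact: win_now.
  apply: win_step ((cpre_eff _ _ rG T_det TJ Gs).1 hc) _ => mu u s' h tr.
  by apply: win_now; apply: h.
Qed.

(** * The main loop *)

(** All values of the main loop have this property, since lemmas are substituted for the symbols
    before a formula is stored. *)
Definition symbol_free (Sg : signature) (D : Type) (X : finType)
    (T : theory Sg D) (V : Type) (A : fm (ext Sg X) V) : Prop :=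
  stable T (fun _ _ => True) A.

Lemma den_holds (Sg : signature) (D : Type) (X Y : finType) (Loc : eqType)
    (G : rpg Sg D X Y Loc) (J : interp (ext Sg X) D) (d : dom Sg X Loc) s :
  determinate (thy G) -> ext_theory (thy G) J ->
  (forall l, symbol_free (thy G) (d l)) -> den G d s <-> holds G J d s.
Proof.
move=> T_det TJ sd; split=> -[Gs h]; split=> //; first by case: (h J TJ).
move=> J' TJ'; split; first exact/(sd _ J).
by apply/(sat_up_models _ _ T_det TJ'); case: Gs.
Qed.

(** Triples that do not occur may be interpreted by the lemma with conclusion
    false, so all triples denote acceleration lemmas. *)
Lemma good_instance_total (Sg : signature) (D : Type) (X : finType)
    (T : theory Sg D) (Psi : fm (ext Sg X) void) (A : fm (ext Sg X) X) lam :
  (exists J, T J) -> good_instance T Psi A lam ->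
  exists lam', [/\ forall k, acc_lemma T (lam' k),
    valid (ext_theory (X := X) T) (inst lam' Psi) & inst lam' A = inst lam A].
Proof.
move=> [J TJ] [acc val].
exists (fun k => if occurs k Psi || occurs k A then lam k
                 else LemmaTriple fTop fTop fBot).
split=> [k||].
- case: ifP => [/acc //|_]; split=> [alpha h|nu nu' h]; by case: (h J TJ).
- suff -> : inst (fun k => if occurs k Psi || occurs k A then lam k
      else LemmaTriple fTop fTop fBot) Psi = inst lam Psi by [].
  by apply: eq_inst => k ->.
by apply: eq_inst => k ->; rewrite orbT.
Qed.

Section MainLoop.

Variables (Sg : signature) (D : Type) (X Y : finType) (Loc : eqType).
Variables (G : rpg Sg D X Y Loc) (p : player) (H : heuristics Sg D X Y Loc).
Variables (J : interp (ext Sg X) D) (R : Loc * (X -> D) -> Prop).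
Hypotheses (rG : regular G) (T_det : determinate (thy G)).
Hypothesis TJ : ext_theory (thy G) J.

(** The invariant of the main loop: [c] lies between the goal and its attractor, and its meaning
    does not depend on [J]. *)
Record approx (c : dom Sg X Loc) : Prop := Approx {
  approx_free : forall l, symbol_free (thy G) (c l);
  approx_goal : forall s, R s -> holds G J c s;
  approx_win : forall s, holds G J c s -> win G p R s }.

(** Records how [c] arose from [b]. Once the loop finds the two equivalent, [c] is closed under its
    own predecessors. *)
Definition pre_closed (b c : dom Sg X Loc) : Prop := forall s,
  eff G p s (fun mu u => forall s', trans G s mu u s' -> holds G J b s') ->
  holds G J c s.

Lemma approx_cpre c : approx c ->
  approx (dor c (cpre G p c)) /\ pre_closed c (dor c (cpre G p c)).
Proof.
move=> [fc gc wc]; split.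
  split=> [l|s /gc [Gs cs]|s [Gs [cs|hc]]].
  - by apply: stable_or; [apply: fc|apply: stable_cpre].
  - by split=> //; left.
  - by apply: wc.
  apply: win_step ((cpre_eff _ _ rG T_det TJ Gs).1 hc) _ => mu u s' h tr.
  by apply: wc; apply: h.
move=> s e; have Gs : is_state G s by case: e.
by split=> //; right; apply/(cpre_eff _ _ rG T_det TJ Gs).
Qed.

(** Soundness of acceleration is applied in the interpretation given by the chosen lemmas, where
    validity of the instance makes the constraint true. As [c] is symbol free, a win for [c] there
    is also one in [J]. *)
Lemma approx_acc c l U Psi A U' A' :
  approx c -> l \in locs G -> accA H G p l c U Psi A U' ->
  instantiate_lemmas (thy G) Psi A A' -> approx (dset c l (fOr (c l) A')).
Proof.
move=> [fc gc wc] lG hacc hinst.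
have fresh_c : fresh_consts (thy G) U c.
  by move=> j l' _ J1 J2 T1 T2 _; apply: fc.
have [acc_sound _] := accA_iterA_sound H.
have [_ [k eA] sound] := acc_sound _ _ _ _ _ _ _ _ hacc rG T_det lG fresh_c.
suff [fA' wA'] : symbol_free (thy G) A' /\ forall nu, is_state G (l, nu) ->
    sat J nu A' -> win G p (holds G J c) (l, nu).
  split=> [l'|s /gc [Gs cs]|[l' nu] [Gs]]; rewrite ?/dset /=.
  - by case: eqP => _; [apply: stable_or; [apply: fc|apply: fA']|apply: fc].
  - by split=> //; rewrite /dset; case: eqP => [<-|//]; left.
  case: eqP => [el|_] h; last exact: wc.
  move: Gs; rewrite el => Gs; case: h => h; first exact: wc.
  exact: win_trans wc (wA' nu Gs h).
case: hinst => [lam good|_]; last by split=> // J1 J2.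
have [|lam' [acc val <-]] := good_instance_total _ good.
  by exists (reduct J).
split=> [J1 J2 T1 T2 _ nu|nu Gs /sat_inst hA].
  rewrite !sat_inst eA /= !sat_up.
  by rewrite !(determinate_sat _ _ T_det T1 T2).
have TJ' : ext_theory (thy G) (set_lemmas J lam') by [].
have accJ' k' : lemma_interp (set_lemmas J lam') k'.
  exact: lemma_interp_set_lemmas T_det TJ (acc k').
have hPsi := (sat_inst _ _ _ _).1 (val J TJ).
apply: win_trans (sound _ _ TJ' accJ' hPsi nu Gs hA) => s [Gs' cs].
by apply: win_now; split=> //; apply/(fc _ _ _ TJ TJ').
Qed.

Lemma attr_loop_win b c U a :
  attr_loop H G p b c U a -> (forall l, symbol_free (thy G) (b l)) ->
  approx c -> pre_closed b c ->
  (forall l, symbol_free (thy G) (a l)) /\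
  forall s, holds G J a s <-> win G p R s.
Proof.
elim=> {b c U a} [b c U bc fb ac cl|b c U l Psi A U' A' a|b c U a].
- have [fc gc wc] := ac; split=> // s; split; first exact: wc.
  (* Leastness of [win]: a state from which [c] is forced also forces [b], as the two are equivalent
     on exit, and so lies in [c]. *)
  elim=> {s} [s /gc //|s M eM _ IH]; apply: cl; apply: eff_mono eM.
  move=> mu u Mu s' tr; apply/(den_holds _ T_det TJ fb)/bc.
  by apply/(den_holds _ T_det TJ fc); apply: IH Mu tr.
- move=> _ hl hacc hinst _ IH _ ac _.
  have ac' := approx_acc ac (accelerate_loc hl) hacc hinst.
  by have [ac2 cl2] := approx_cpre ac'; apply: IH => //; case: ac'.
- move=> _ _ _ IH _ ac _.
  by have [ac2 cl2] := approx_cpre ac; apply: IH => //; case: ac.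
Qed.

End MainLoop.

(** * Correctness of the accelerated attractor computation *)

Theorem theorem7p7 (Sg : signature) (D : Type) (X Y : finType) (Loc : eqType)
    (G : rpg Sg D X Y Loc) (G_wf : rpg_wf G)
    (G_determinate : determinate (thy G)) (G_input_enabled : input_enabled G)
    (p : player) (d : Loc -> fm Sg X) (H : heuristics Sg D X Y Loc)
    (a : dom Sg X Loc) :
  attractor_acc H G p (updom d) a ->
  forall s : Loc * (X -> D), den G a s <-> attr G p (den G (updom d)) s.
Proof.
move=> ha s; have rG := wf_regular G_wf G_input_enabled.
case: (classic (is_state G s)) => [Gs|nGs]; last by split=> -[].
(* Over an empty theory every formula is modelled, so both sides contain every state. *)
case: (classic (exists J, thy G J)) => [[J0 TJ0]|noJ]; last first.
  have all_den d' : den G d' s by split=> // J TJ; case: noJ; exists (reduct J).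
  by split=> // _; apply: win_attr => //; apply: win_now.
(* The added symbols get arbitrary meanings; [s.2] supplies elements of [D] for the constants. *)
pose J : interp (ext Sg X) D := @Interp (ext Sg X) D
  (fun f => match f return ('I_(@far (ext Sg X) f) -> D) -> D with
   | inl f => fint J0 (f := f) | inr (_, x) => fun _ => s.2 x end)
  (fun q => match q return ('I_(@par (ext Sg X) q) -> D) -> Prop with
   | inl q => pint J0 (q := q) | inr _ => fun _ => False end).
have TJ : ext_theory (thy G) J by rewrite /ext_theory; case: J0 TJ0 @J.
have fd l : symbol_free (thy G) (updom d l) by apply: stable_up.
have dh s' := den_holds s' G_determinate TJ fd.
have ac : approx G p J (den G (updom d)) (updom d).
  split=> // s' h; first exact/dh.
  by apply: win_now; apply/dh.
have [||fa ha'] := attr_loop_win rG G_determinate TJ ha _ ac.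
- by move=> l J1 J2.
(* A round in the forced set can always be played, so no state is a predecessor of the empty set. *)
- by move=> s' /(eff_round rG) [mu [u [s1 [h /h []]]]].
rewrite (den_holds _ G_determinate TJ fa) ha'; split; first exact: win_attr.
exact: attr_win.
Qed.
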